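(* Let $(X,F)$ be a tropical Hopf data of dimension $2$ (data for a tropical Hopf surface), where $X\subset\mathbb{T}^n$ is not homeomorphic to $\mathbb{T}^2$ and $F:\mathbb{T}^n\to\mathbb{T}^n$ is a contracting automorphism. Suppose $(X,F)$ is realizable by a Hopf surface defined over $\mathbb{K}$ by a germ $\mathbf{f}$ defined over $\mathbb{K}$. Then $\mathbf{f}$ is conjugate to $(x,y)\mapsto(\alpha x,\beta y)$, where $\nu_0(\alpha),\nu_0(\beta)>0$ and $\alpha^k=\beta^l$ for some $k,l\in\mathbb{N}^*$.
   Context: $\mathbb{K}$ is an algebraically closed field of characteristic $0$ with a non-trivial rank-one valuation $\nu_0$ with value group $\mathbb{R}$; $\mathbb{A}^n$ is affine space over $\mathbb{K}$; $\mathbb{N}^*=\{1,2,\dots\}$. $\mathbb{T}=\mathbb{R}\cup\{\infty\}$ with min-plus operations, topologized by Euclidean open sets and the sets $(a,\infty]$; $\infty$ also denotes $(\infty,\dots,\infty)$. A point $x\in\mathbb{T}^n$ has sedentarity $I$ if $x_i=\infty\iff i\in I$; $\mathbb{R}^n_I$ is the set of such points. A tropical subvariety of $\mathbb{T}^n$ of sedentarity $\emptyset$ is the closure of a pure-dimensional finite rational polyhedral complex in $\mathbb{R}^n$, with positive integer weights on facets, that is balanced. For a subvariety $\mathbf{V}\subset\mathbb{A}^n$, $\mathrm{Trop}(\mathbf{V})=\overline{\nu_0(\mathbf{V})}\subset\mathbb{T}^n$ (coordinatewise valuation, $\nu_0(0)=\infty$), with the usual tropical multiplicities as weights; for an embedding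 $i:\mathbb{A}^d\to\mathbb{A}^n$, $\mathcal{T}_i(\mathbb{A}^d)=\mathrm{Trop}(i(\mathbb{A}^d))$. The tropicalization of a polynomial map is obtained by replacing each $\sum\alpha_Ix^I$ by $\bigwedge_I(\nu_0(\alpha_I)+\langle I,x\rangle)$. Non-singularity. A linear space in $\mathbb{A}^n$ is generic if its closure in $\mathbb{P}^n$ meets all intersections of coordinate hyperplanes in the expected dimension; one through $0$ is generic if the same holds except at $0$. For $V\subset\mathbb{T}^n$ of sedentarity $\emptyset$ and codimension $k$, and $x\in V\cap\mathbb{R}^n$, $\deg_V(x)=\min_{\phi\in GL_n(\mathbb{Z})}w_x(V\cdot\phi(L_x^k))$, where $L_x$ is the tropicalization of a generic hyperplane with vertex at $x$, powers and products are tropical stable intersections and $w_x$ is the weight at $x$; $\deg_V(\infty)=|V\cdot L^k|-|V\cdot L^k_\infty|$, where $|\cdot|$ is the sum of the weights over points of $\mathbb{R}^n$ and $L$, $L_\infty$ are tropicalizations of a generic hyperplane, resp. a generic hyperplane through $0$. $V$ is non-singular if it meets every $\mathbb{R}^n_I$, $I\subsetneq\{1,\dots,n\}$, properly (in codimension $|I|$) and its degree is $1$ at $\infty$ and at all points of empty sedentarity. A non-singular germ is the intersection of a tropical subvariety with a small neighborhood of $\infty$ in which it is non-singular. Modifications. Given $V\subset\mathbb{T}^n$ and a tropical polynomial $P$, the regular modification $\pi_P:\widetilde V\to V$ is the projection from $\widetilde V\subset\mathbb{T}^{n+1}$, the graph of $P|_V$ completed, at each codimension-one face where balancing fails, by a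 facet in direction $e_{n+1}$ with the unique positive weight restoring balancing; $\mathrm{div}_V(P)$ is the image of the added facets. For $P=P_1-P_2$ with $\mathrm{div}_V(P_1)-\mathrm{div}_V(P_2)$ effective, the same construction gives a rational modification. A modification is a composition of regular or rational modifications. A tropical Hopf data of dimension $d$ is a pair $(X,F)$ where $X\subseteq\mathbb{T}^n$ is a non-singular germ at $\infty$ of a tropical variety obtained from a modification $X\to\mathbb{T}^d$, and $F:\mathbb{T}^n\to\mathbb{T}^n$ is a permutation of coordinates composed with a translation which is contracting (every neighborhood $U$ of $\infty$ contains a neighborhood $V$ of $\infty$ with $\overline{F(V)}\subset V$) and satisfies $F(X)\subset X$. For such data $X$ is a neighborhood of $\infty$ in a tropical variety on which $F$ acts as an automorphism, and $X$ is identified with this variety. Realization. A realization of $(X,F)$ is a pair $(i,\mathbf{F})$ with $i:\mathbb{A}^d\to\mathbb{A}^n$ an embedding ($i(0)=0$) such that $\mathcal{T}_i(\mathbb{A}^d)=X$, and $\mathbf{F}:(\mathbb{A}^n,0)\to(\mathbb{A}^n,0)$ a contracting automorphism with $\mathrm{Trop}(\mathbf{F})=F$ and $\mathbf{F}(i(\mathbb{A}^d))=i(\mathbb{A}^d)$. It induces a contracting automorphism $\mathbf{f}$ of $(\mathbb{A}^d,0)$ by $i\circ\mathbf{f}=\mathbf{F}\circ i$; then $(X,F)$ is said to be realizable by (the Hopf manifold defined by) $\mathbf{f}$. Conjugate means conjugate by an invertible analytic germ at $0$. *)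

(* Defs.v *)
(* mpoly has to be imported before the classical layer: in the other order
   their notations clash. *)
From HB Require Import structures.
From mathcomp Require Import all_boot all_order all_algebra perm.
From mathcomp Require Import mpoly.
From mathcomp Require Import all_classical all_reals.
From mathcomp Require Import ereal topology.

Set Implicit Arguments.
Unset Strict Implicit.
Unset Printing Implicit Defensive.
Import Order.TTheory GRing.Theory Num.Theory.
Local Open Scope classical_set_scope.
Local Open Scope ring_scope.

(* T is [\bar R] without [-oo]; its topology (Euclidean open sets and the
   ]a, +oo]) is the one induced by [\bar R].  T^n is open in ['rV[\bar R]_n],
   so the open subsets of T^n are the open sets contained in [Tspace]. *)
Definition Tspace (R : realType) (n : nat) : set 'rV[\bar R]_n :=
  [set x | forall j, x ord0 j != -oo%E].
Arguments Tspace R n : clear implicits.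

Definition Tinfty (R : realType) (n : nat) : 'rV[\bar R]_n := const_mx +oo%E.
Arguments Tinfty R n : clear implicits.

Definition toT (R : realType) (n : nat) (x : 'rV[R]_n) : 'rV[\bar R]_n :=
  map_mx EFin x.

Definition tclosure (R : realType) (n : nat) (A : set 'rV[\bar R]_n) :
  set 'rV[\bar R]_n := closure A `&` Tspace R n.

Definition Tnbhs_infty (R : realType) (n : nat) (U : set 'rV[\bar R]_n) : Prop :=
  [/\ open U, U `<=` Tspace R n & U (Tinfty R n)].

Definition stratum (R : realType) (n : nat) (I : {set 'I_n}) :
  set 'rV[\bar R]_n :=
  [set x | Tspace R n x /\ forall j, (x ord0 j == +oo%E) = (j \in I)].
Arguments stratum R {n} I.

Definition homeomorphic (S T : topologicalType) (A : set S) (B : set T) : Prop :=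
  exists (f : S -> T) (g : T -> S),
    [/\ f @` A `<=` B, g @` B `<=` A, {within A, continuous f},
        {within B, continuous g} &
        (forall x, A x -> g (f x) = x) /\ (forall y, B y -> f (g y) = y)].

Definition dotp (R : realType) (n : nat) (a x : 'rV[R]_n) : R :=
  \sum_(j < n) a ord0 j * x ord0 j.

Definition realv (R : realType) (n : nat) (z : 'rV[int]_n) : 'rV[R]_n :=
  map_mx intr z.

Definition rational_polyhedron (R : realType) (n : nat) (P : set 'rV[R]_n) : Prop :=
  exists s : seq ('rV[int]_n * R),
    P = [set x | forall c, c \in s -> dotp (realv R c.1) x <= c.2].

(* P is a face of itself (a = 0). *)
Definition is_face (R : realType) (n : nat) (Q P : set 'rV[R]_n) : Prop :=
  Q !=set0 /\ exists (a : 'rV[R]_n) (b : R),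
    (forall x, P x -> dotp a x <= b) /\ Q = P `&` [set x | dotp a x = b].

(* Direction space of the affine hull: for a convex P this set of multiples of
   differences is already a linear subspace. *)
Definition tangent (R : realType) (n : nat) (P : set 'rV[R]_n) : set 'rV[R]_n :=
  [set v | exists x y (c : R), [/\ P x, P y & v = c *: (y - x)]].

Definition pdim (R : realType) (n : nat) (P : set 'rV[R]_n) : nat :=
  xget 0%N [set r | exists B : 'M[R]_(r, n),
    row_free B /\ forall v : 'rV[R]_n, tangent P v <-> (v <= B)%MS].

Definition relint (R : realType) (n : nat) (P : set 'rV[R]_n) : set 'rV[R]_n :=
  [set x | P x /\ forall y, P y -> exists2 e : R, 0 < e & P (x + e *: (x - y))].

(* N_P, the integral vectors parallel to P *)
Definition lattice (R : realType) (n : nat) (P : set 'rV[R]_n) : set 'rV[int]_n :=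
  [set z | tangent P (realv R z)].

Record wcomplex (R : realType) (n : nat) := WComplex {
  cells : set (set 'rV[R]_n);
  wdim : nat;
  weight : set 'rV[R]_n -> nat  (* only its values on facets matter *)
}.

Definition facets (R : realType) (n : nat) (X : wcomplex R n) :
  set (set 'rV[R]_n) := [set s | cells X s /\ pdim s = wdim X].

Definition ridges (R : realType) (n : nat) (X : wcomplex R n) :
  set (set 'rV[R]_n) := [set t | cells X t /\ (pdim t).+1 = wdim X].

Definition star (R : realType) (n : nat) (X : wcomplex R n) (t : set 'rV[R]_n) :
  set (set 'rV[R]_n) := [set s | facets X s /\ t `<=` s].

Definition supp (R : realType) (n : nat) (X : wcomplex R n) : set 'rV[R]_n :=
  \bigcup_(s in cells X) s.

Definition weighted_complex (R : realType) (n : nat) (X : wcomplex R n) : Prop :=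
  [/\ finite_set (cells X),
      (forall s, cells X s -> s !=set0 /\ rational_polyhedron s),
      (forall s t, cells X s -> is_face t s -> cells X t),
      (forall s t, cells X s -> cells X t -> s `&` t !=set0 ->
         is_face (s `&` t) s /\ is_face (s `&` t) t) &
      (forall s, cells X s -> exists2 t, facets X t & s `<=` t) /\
      (forall s, facets X s -> (0 < weight X s)%N)].

(* v generates N_s modulo N_t and points from the ridge t into the facet s. *)
Definition primitive_normal (R : realType) (n : nat) (t s : set 'rV[R]_n)
    (v : 'rV[int]_n) : Prop :=
  [/\ lattice s v,
      (forall z, lattice s z ->
         exists (a : int) (u : 'rV[int]_n), lattice t u /\ z = a *: v + u) &
      exists (x : 'rV[R]_n) (e : R), [/\ t x, 0 < e & s (x + e *: realv R v)]].

Definition balanced (R : realType) (n : nat) (X : wcomplex R n) : Prop :=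
  forall t, ridges X t ->
    exists v : set 'rV[R]_n -> 'rV[int]_n,
      (forall s, star X t s -> primitive_normal t s (v s)) /\
      tangent t (\sum_(s \in star X t) realv R (v s) *+ weight X s).

(* Together with [tset X], its closure in T^n, such an X is a tropical
   subvariety of T^n of empty sedentarity. *)
Definition tropical_variety (R : realType) (n : nat) (X : wcomplex R n) : Prop :=
  weighted_complex X /\ balanced X.

Definition tset (R : realType) (n : nat) (X : wcomplex R n) : set 'rV[\bar R]_n :=
  tclosure (@toT R n @` supp X).

(* Equality of tropical cycles inside U, independently of the polyhedral
   structures that carry the weights. *)
Definition cycle_eq_on (R : realType) (n : nat) (U : set 'rV[\bar R]_n)
    (X Y : wcomplex R n) : Prop :=
  [/\ wdim X = wdim Y, tset X `&` U = tset Y `&` U &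
      forall s t x, facets X s -> facets Y t -> relint s x -> relint t x ->
        U (toT x) -> weight X s = weight Y t].

Definition cycle_eq (R : realType) (n : nat) (X Y : wcomplex R n) : Prop :=
  cycle_eq_on setT X Y.

Definition fullspace (R : realType) (n : nat) : wcomplex R n :=
  WComplex [set setT] n (fun=> 1%N).

(* [Z^n : N_s + N_t]; the value is 0 when the index is infinite. *)
Definition lattice_index (R : realType) (n : nat) (s t : set 'rV[R]_n) : nat :=
  xget 0%N [set m | exists r : 'I_m -> 'rV[int]_n, forall z, exists! i,
    exists u w, [/\ lattice s u, lattice t w & z = r i + u + w]].

(* "for v outside finitely many hyperplanes" *)
Definition for_generic (R : realType) (n : nat) (P : 'rV[R]_n -> Prop) : Prop :=
  exists A : seq 'rV[R]_n, (forall a, a \in A -> a != 0) /\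
    forall v, (forall a, a \in A -> dotp a v != 0) -> P v.

(* Fan displacement rule at x: pairs of facets through x that still meet after
   a small displacement e *: v of the second one.  By convexity, if some e > 0
   works then so does every smaller one. *)
Definition displaced_pairs (R : realType) (n : nat) (X Y : wcomplex R n)
    (v x : 'rV[R]_n) : set (set 'rV[R]_n * set 'rV[R]_n) :=
  [set p | [/\ facets X p.1, facets Y p.2, p.1 x, p.2 x &
      exists (e : R) (y : 'rV[R]_n), [/\ 0 < e, p.1 y & p.2 (y - e *: v)]]].

Definition displaced_weight (R : realType) (n : nat) (X Y : wcomplex R n)
    (v x : 'rV[R]_n) : nat :=
  (\sum_(p \in displaced_pairs X Y v x)
    (weight X p.1 * weight Y p.2 * lattice_index p.1 p.2))%N.

(* Z carries the stable intersection X . Y; its cells may have to be chosen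
   small enough for the weight formula to hold on the whole relative interior
   of a facet. *)
Definition stable_intersection (R : realType) (n : nat) (X Y Z : wcomplex R n) :
  Prop :=
  [/\ weighted_complex Z, (wdim X + wdim Y = n + wdim Z)%N,
      (forall x, supp Z x <->
         for_generic (fun v => (0 < displaced_weight X Y v x)%N)) &
      forall s x, facets Z s -> relint s x ->
        for_generic (fun v => displaced_weight X Y v x = weight Z s)].

Inductive stable_power (R : realType) (n : nat) (L : wcomplex R n) :
    nat -> wcomplex R n -> Prop :=
| stable_power0 : stable_power L 0 (fullspace R n)
| stable_powerS k M Z : stable_power L k M -> stable_intersection M L Z ->
    stable_power L k.+1 Z.

Definition point_weight (R : realType) (n : nat) (Z : wcomplex R n)
    (x : 'rV[R]_n) : nat :=
  (\sum_(s \in [set s | facets Z s /\ s x]) weight Z s)%N.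

Definition total_weight (R : realType) (n : nat) (Z : wcomplex R n) : nat :=
  (\sum_(s \in facets Z) weight Z s)%N.

(* GL_n(Z) acts with x as the origin. *)
Definition gl_act (R : realType) (n : nat) (x : 'rV[R]_n) (phi : 'M[int]_n)
    (y : 'rV[R]_n) : 'rV[R]_n := x + (y - x) *m map_mx intr phi.

Definition gl_image (R : realType) (n : nat) (x : 'rV[R]_n) (phi : 'M[int]_n)
    (X : wcomplex R n) : wcomplex R n :=
  WComplex [set gl_act x phi @` s | s in cells X] (wdim X)
           (fun t => weight X (gl_act x phi @^-1` t)).

Definition valuation (R : realType) (K : fieldType) (nu : K -> \bar R) : Prop :=
  [/\ (forall a, nu a != -oo%E),
      (forall a, nu a = +oo%E <-> a = 0),
      (forall a b, nu (a * b) = (nu a + nu b)%E),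
      (forall a b, (mine (nu a) (nu b) <= nu (a + b)%R)%E) &
      forall r : R, exists a, nu a = r%:E].

Section Multiplicity.
Variables (R : realType) (K : fieldType) (nu : K -> \bar R) (n : nat).
Implicit Types (J P Q : set {mpoly K[n]}).

(* O[x] and m[x], with O the valuation ring of nu and m its maximal ideal *)
Definition integral_poly : set {mpoly K[n]} :=
  [set p | forall e, (0%E <= nu p@_e)%E].
Definition maximal_poly : set {mpoly K[n]} :=
  [set p | forall e, (0%E < nu p@_e)%E].

Definition vanishing_ideal (V : set 'rV[K]_n) : set {mpoly K[n]} :=
  [set p | forall x, V x -> p.@[fun j => x ord0 j] = 0].

Definition rescale (tau : 'I_n -> K) (p : {mpoly K[n]}) : {mpoly K[n]} :=
  p \mPo [tuple (tau j)%:MP * 'X_j | j < n].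

(* Inverse image in O[x] of the initial ideal in_w(I(V)) over the residue
   field O/m, where tau is a point of the torus of valuation w; another choice
   of tau only translates it in the residual torus.  Ideals over the residue
   field are represented below by the ideals of O[x] that contain m[x]. *)
Definition initial_ideal (V : set 'rV[K]_n) (tau : 'I_n -> K) :
  set {mpoly K[n]} :=
  [set q | integral_poly q /\ exists p, [/\ vanishing_ideal V p,
     integral_poly (rescale tau p) & maximal_poly (q - rescale tau p)]].

Definition is_ideal J : Prop :=
  [/\ J `<=` integral_poly, J 0, (forall p q, J p -> J q -> J (p + q)) &
      forall p q, integral_poly p -> J q -> J (p * q)].

Definition is_prime P : Prop :=
  [/\ is_ideal P, ~ P 1 &
      forall p q, integral_poly p -> integral_poly q -> P (p * q) -> P p \/ P q].

(* the irreducible components of the subscheme of the torus defined by J: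
   minimal primes over J that contain no variable *)
Definition torus_components J : set (set {mpoly K[n]}) :=
  [set P | [/\ is_prime P, J `<=` P, (forall j, ~ P 'X_j) &
      forall Q, is_prime Q -> J `<=` Q -> Q `<=` P -> Q = P]].

(* contractions of the ideals of the localization of O[x] at the prime P *)
Definition local_ideal P Q : Prop :=
  is_ideal Q /\ forall p q, integral_poly p -> integral_poly q ->
    ~ P q -> Q (p * q) -> Q p.

Definition local_chain J P (l : nat) : Prop :=
  exists c : nat -> set {mpoly K[n]},
    (forall i, (i <= l)%N -> local_ideal P (c i) /\ J `<=` c i) /\
    (forall i, (i < l)%N -> c i `<` c i.+1).

(* length of O[x]_P / J O[x]_P *)
Definition local_length J P : nat :=
  xget 0%N [set l | local_chain J P l /\
                    forall k, local_chain J P k -> (k <= l)%N].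

(* Tropical multiplicity of Trop(V) at nu(tau): number of irreducible
   components of the initial degeneration, counted with multiplicity. *)
Definition trop_mult (V : set 'rV[K]_n) (tau : 'I_n -> K) : nat :=
  (\sum_(P \in torus_components (initial_ideal V tau))
      local_length (initial_ideal V tau) P)%N.

Definition trop_set (V : set 'rV[K]_n) : set 'rV[\bar R]_n :=
  tclosure (@map_mx _ _ nu 1 n @` V).

(* X carries the part of Trop(V) in R^n, with its multiplicities. *)
Definition trop_cycle (V : set 'rV[K]_n) (X : wcomplex R n) : Prop :=
  [/\ weighted_complex X, (forall x, supp X x <-> trop_set V (toT x)) &
      forall s x tau, facets X s -> relint s x ->
        (forall j, nu (tau j) = (x ord0 j)%:E) -> trop_mult V tau = weight X s].

Definition hyperplane (a0 : K) (a : 'I_n -> K) : set 'rV[K]_n :=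
  [set y | a0 + \sum_(j < n) a j * y ord0 j = 0].

(* A hyperplane is generic (its closure in P^n meets the coordinate subspaces
   in the expected dimension) iff all its coefficients are nonzero; if it goes
   through 0, iff all of them except a0 are.  Its tropicalization has vertex x
   when the n + 1 tropical monomials agree at x. *)
Definition trop_hyperplane (x : 'rV[R]_n) (L : wcomplex R n) : Prop :=
  (wdim L).+1 = n /\ exists (a0 : K) (a : 'I_n -> K),
    [/\ a0 != 0, (forall j, a j != 0),
        (forall j, nu a0 = (nu (a j) + (x ord0 j)%:E)%E) &
        trop_cycle (hyperplane a0 a) L].

Definition trop_hyperplane_infty (L : wcomplex R n) : Prop :=
  (wdim L).+1 = n /\ exists a : 'I_n -> K,
    (forall j, a j != 0) /\ trop_cycle (hyperplane 0 a) L.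

(* m = w_x (V . phi(L_x^k)), k the dimension of V *)
Definition local_weight (V : wcomplex R n) (x : 'rV[R]_n) (phi : 'M[int]_n)
    (m : nat) : Prop :=
  exists L Lk Z, [/\ trop_hyperplane x L, stable_power L (wdim V) Lk,
    stable_intersection V (gl_image x phi Lk) Z & m = point_weight Z x].

Definition degree_at (V : wcomplex R n) (x : 'rV[R]_n) (m : nat) : Prop :=
  (exists2 phi, phi \in unitmx & local_weight V x phi m) /\
  (forall phi k, phi \in unitmx -> local_weight V x phi k -> (m <= k)%N).

Definition degree_infty (V : wcomplex R n) (m : nat) : Prop :=
  exists x L Lk Z L' Lk' Z',
    [/\ trop_hyperplane x L, stable_power L (wdim V) Lk &
        stable_intersection V Lk Z] /\
    [/\ trop_hyperplane_infty L', stable_power L' (wdim V) Lk',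
        stable_intersection V Lk' Z' &
        (total_weight Z = m + total_weight Z')%N].

(* adequate for finite unions of polyhedra, possibly intersected with an open
   set *)
Definition set_dim (S : set 'rV[R]_n) (r : nat) : Prop :=
  let convex_in C := [/\ C !=set0, C `<=` S & forall x y (t : R), C x -> C y ->
                        0 <= t -> t <= 1 -> C (t *: x + (1 - t) *: y)] in
  (exists2 C, convex_in C & pdim C = r) /\
  (forall C, convex_in C -> (pdim C <= r)%N).

(* The stratum of sedentarity I is embedded in R^n by putting 0 at the infinite
   coordinates. *)
Definition meets_properly (U : set 'rV[\bar R]_n) (V : wcomplex R n)
    (I : {set 'I_n}) : Prop :=
  let S := @map_mx _ _ fine 1 n @` (tset V `&` U `&` stratum R I) in
  S !=set0 -> exists2 r, set_dim S r & (r + #|I|)%N = wdim V.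

Definition nonsingular_in (U : set 'rV[\bar R]_n) (V : wcomplex R n) : Prop :=
  [/\ (forall I : {set 'I_n}, I \proper [set: 'I_n]%SET -> meets_properly U V I),
      degree_infty V 1 &
      forall x, supp V x -> U (toT x) -> degree_at V x 1].

End Multiplicity.

Definition tpoly (R : realType) (n : nat) : Type := seq (\bar R * 'X_{1..n}).

Definition teval (R : realType) (n : nat) (P : tpoly R n) (x : 'rV[\bar R]_n) :
  \bar R :=
  \big[mine/+oo%E]_(c <- P) (c.1 + \sum_(j < n) (x ord0 j *+ c.2 j))%E.

Definition finite_tpoly (R : realType) (n : nat) (P : tpoly R n) : Prop :=
  P != [::] /\ forall c, c \in P -> c.1 \is a fin_num.

Definition tfun (R : realType) (n : nat) (P : tpoly R n) (x : 'rV[R]_n) : R :=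
  fine (teval P (toT x)).

Definition extend (A : Type) (n : nat) (x : 'rV[A]_n) (t : A) : 'rV[A]_(n + 1) :=
  row_mx x (const_mx t).

Definition graph_cell (R : realType) (n : nat) (f : 'rV[R]_n -> R)
    (s : set 'rV[R]_n) : set 'rV[R]_(n + 1) :=
  [set extend x (f x) | x in s].

(* with the min convention, the added facets go up, towards +oo *)
Definition upper_cell (R : realType) (n : nat) (f : 'rV[R]_n -> R)
    (s : set 'rV[R]_n) : set 'rV[R]_(n + 1) :=
  [set y | exists x t, [/\ s x, f x <= t & y = extend x t]].

(* m is the weight in the direction e_{n+1} that balances the graph of f along
   the ridge t, i.e. the coefficient of t in div_V(f). *)
Definition order_along (R : realType) (n : nat) (V : wcomplex R n)
    (f : 'rV[R]_n -> R) (t : set 'rV[R]_n) (m : int) : Prop :=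
  exists v : set 'rV[R]_n -> 'rV[int]_(n + 1),
    (forall s, star V t s ->
       primitive_normal (graph_cell f t) (graph_cell f s) (v s)) /\
    tangent (graph_cell f t)
      ((\sum_(s \in star V t) realv R (v s) *+ weight V s)
       + realv R (extend (0 : 'rV[int]_n) 1) *~ m).

(* Rational modification along P1 - P2; the regular ones are those where P2 is
   the constant 0.  V' is a subdivision of V on which P1 and P2 are affine,
   ord1 - ord2 >= 0 is the effectivity of div(P1) - div(P2).  The last clause
   excludes poles of P1 - P2 along the faces of V at infinity. *)
Definition elementary_modification (R : realType) (n : nat) (V : wcomplex R n)
    (W : wcomplex R (n + 1)) : Prop :=
  exists (P1 P2 : tpoly R n) (V' : wcomplex R n)
         (ord1 ord2 : set 'rV[R]_n -> int),
    let f x := tfun P1 x - tfun P2 x in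
    let added t := ridges V' t /\ ord2 t < ord1 t in
    [/\ finite_tpoly P1 /\ finite_tpoly P2,
        [/\ weighted_complex V', cycle_eq V V' &
            forall s P, cells V' s -> P = P1 \/ P = P2 ->
              exists (a : 'rV[R]_n) b, forall x, s x -> tfun P x = dotp a x + b],
        (forall t, ridges V' t ->
           [/\ order_along V' (tfun P1) t (ord1 t),
               order_along V' (tfun P2) t (ord2 t) & ord2 t <= ord1 t]),
        [/\ cells W = [set graph_cell f s | s in cells V'] `|`
              [set upper_cell f s | s in
                 [set s | cells V' s /\ exists2 t, added t & s `<=` t]],
            wdim W = wdim V',
            (forall s, facets V' s -> weight W (graph_cell f s) = weight V' s) &
            (forall t, added t ->
               ((weight W (upper_cell f t))%:Z = ord1 t - ord2 t)%R)] &
        [set lsubmx y | y in tset W] = tset V].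

Inductive modification_of_Td (R : realType) (d : nat) :
    forall n : nat, wcomplex R n -> Prop :=
| modification_id : modification_of_Td d (fullspace R d)
| modification_step n (V : wcomplex R n) (W : wcomplex R (n + 1)) :
    modification_of_Td d V -> elementary_modification V W ->
    modification_of_Td d W.

Definition trop_contracting (R : realType) (n : nat)
    (F : 'rV[\bar R]_n -> 'rV[\bar R]_n) : Prop :=
  forall U, Tnbhs_infty U ->
    exists V, [/\ Tnbhs_infty V, V `<=` U & tclosure (F @` V) `<=` V].

Definition perm_translation (R : realType) (n : nat)
    (F : 'rV[\bar R]_n -> 'rV[\bar R]_n) : Prop :=
  exists (sigma : 'S_n) (c : 'I_n -> R), forall x, Tspace R n x ->
    F x = \row_j (x ord0 (sigma j) + (c j)%:E)%E.

(* X is the F-invariant tropical variety determined by the germ; the germ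
   itself is X `&` U, and it is the germ at infinity of a modification V of
   T^d. *)
Definition tropical_Hopf_data (R : realType) (K : fieldType) (nu : K -> \bar R)
    (d n : nat) (X : wcomplex R n) (F : 'rV[\bar R]_n -> 'rV[\bar R]_n) : Prop :=
  [/\ tropical_variety X /\ wdim X = d,
      perm_translation F, trop_contracting F, F @` tset X = tset X &
      exists (V : wcomplex R n) (U : set 'rV[\bar R]_n),
        [/\ modification_of_Td d V, Tnbhs_infty U, nonsingular_in nu U V,
            cycle_eq_on U X V & F @` (tset X `&` U) `<=` tset X `&` U]].

Section Realization.
Variables (R : realType) (K : fieldType) (nu : K -> \bar R).

Definition polymap (d n : nat) : Type := n.-tuple {mpoly K[d]}.

Definition polymap_id (n : nat) : polymap n n := [tuple 'X_j | j < n].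

Definition polymap_comp (d n m : nat) (g : polymap n m) (f : polymap d n) :
  polymap d m := [tuple tnth g j \mPo f | j < m].

Definition polymap_eval (d n : nat) (f : polymap d n) (x : 'rV[K]_d) : 'rV[K]_n :=
  \row_j (tnth f j).@[fun k => x ord0 k].

Definition preserves0 (d n : nat) (f : polymap d n) : Prop :=
  polymap_eval f 0 = 0.

(* closed embedding: the comorphism K[x_1..x_n] -> K[z_1..z_d] is onto *)
Definition embedding (d n : nat) (i : polymap d n) : Prop :=
  forall q : {mpoly K[d]}, exists p : {mpoly K[n]}, p \mPo i = q.

Definition automorphism (n : nat) (F : polymap n n) : Prop :=
  exists G : polymap n n, polymap_comp F G = polymap_id n /\
                          polymap_comp G F = polymap_id n.

Definition kball (n : nat) (r : R) : set 'rV[K]_n :=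
  [set x | forall j, (r%:E < nu (x ord0 j))%E].

(* Balls of K are closed as well as open, so the condition "closure of F(V)
   inside V" would not exclude the identity; one asks for the iterates to
   converge to 0 uniformly on V. *)
Definition contracting (n : nat) (F : polymap n n) : Prop :=
  forall r, exists V : set 'rV[K]_n,
    [/\ V `<=` kball r, (exists s, kball s `<=` V),
        polymap_eval F @` V `<=` V &
        forall s, exists N, forall k, (N <= k)%N ->
          iter k (polymap_eval F) @` V `<=` kball s].

Definition trop_poly (n : nat) (p : {mpoly K[n]}) : tpoly R n :=
  [seq (nu p@_e, e) | e <- msupp p].

Definition trop_map (d n : nat) (F : polymap d n) (x : 'rV[\bar R]_d) :
  'rV[\bar R]_n := \row_j teval (trop_poly (tnth F j)) x.

Definition realization (d n : nat) (X : wcomplex R n)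
    (F : 'rV[\bar R]_n -> 'rV[\bar R]_n) (i : polymap d n) (FK : polymap n n) :
  Prop :=
  [/\ embedding i /\ preserves0 i,
      tset X = trop_set nu (range (polymap_eval i)) /\
        trop_cycle nu (range (polymap_eval i)) X,
      [/\ automorphism FK, preserves0 FK & contracting FK],
      (forall x, Tspace R n x -> trop_map FK x = F x) &
      polymap_eval FK @` range (polymap_eval i) = range (polymap_eval i)].

(* Maps (A^d,0) -> (A^n,0) given by power series: [f j e] is the coefficient of
   the monomial e in the j-th component. *)
Definition pseries_map (d n : nat) : Type := 'I_n -> 'X_{1..d} -> K.

Definition pseries_of (d n : nat) (f : polymap d n) : pseries_map d n :=
  fun j e => (tnth f j)@_e.

Definition truncate (d : nat) (k : nat) (a : 'X_{1..d} -> K) : {mpoly K[d]} :=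
  \sum_(e : 'X_{1..d < k.+1}) a e *: 'X_[e].

(* Composition of power series; meaningful when f has no constant term, since
   then the coefficient of e only depends on terms of degree <= mdeg e. *)
Definition pseries_comp (d n m : nat) (g : pseries_map n m)
    (f : pseries_map d n) : pseries_map d m :=
  fun j e => (truncate (mdeg e) (g j) \mPo
              [tuple truncate (mdeg e) (f l) | l < n])@_e.

(* positive radius of convergence *)
Definition convergent (d n : nat) (f : pseries_map d n) : Prop :=
  forall j, exists c r : R, forall e : 'X_{1..d},
    ((c - r * (mdeg e)%:R)%:E <= nu (f j e))%E.

Definition analytic_germ (d n : nat) (f : pseries_map d n) : Prop :=
  (forall j, f j 0%MM = 0) /\ convergent f.

Definition conjugate (d : nat) (f g : pseries_map d d) : Prop :=
  exists phi psi : pseries_map d d,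
    [/\ analytic_germ phi, analytic_germ psi,
        pseries_comp phi psi =2 pseries_of (polymap_id d),
        pseries_comp psi phi =2 pseries_of (polymap_id d) &
        pseries_comp phi f =2 pseries_comp g phi].

Definition realizable_by (d n : nat) (X : wcomplex R n)
    (F : 'rV[\bar R]_n -> 'rV[\bar R]_n) (f : pseries_map d d) : Prop :=
  exists (i : polymap d n) (FK : polymap n n),
    [/\ realization X F i FK, analytic_germ f &
        pseries_comp (pseries_of i) f =2 pseries_of (polymap_comp FK i)].

Definition diagonal_map (a b : K) : polymap 2 2 :=
  [tuple a *: 'X_0; b *: 'X_1].

End Realization.

(* Main.v *)
From HB Require Import structures.
From mathcomp Require Import all_boot all_order all_algebra.
From mathcomp Require Import fingroup perm cyclic separable cyclotomic.
From mathcomp Require Import mpoly.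
From mathcomp Require Import all_classical all_reals.
From mathcomp Require Import ereal topology normedtype.
From mathcomp Require Import ring lra zify.
Require Import Defs.

Set Implicit Arguments.
Unset Strict Implicit.
Unset Printing Implicit Defensive.
Import Order.TTheory GRing.Theory Num.Theory.
Local Open Scope classical_set_scope.
Local Open Scope ring_scope.

(** The components of the automorphism of affine n-space tropicalize to single
monomials of degree one with finite coefficient, so this automorphism is
[x_j |-> a_j x_(sigma j)] with all [a_j] nonzero ([trop_perm_translation]).  The
embedding is given by polynomials [P_1, ..., P_n] that vanish at 0 and generate
[K[x, y]]; through them the germ is a polynomial map [h]
([lift_polynomial]), and the pullback [p |-> p o h] permutes the [P_j] up to
the factors [a_j].

Linearization ([linearize]).  A power of the pullback is diagonal on the span of
the [P_j], so each [P_j] is a sum of eigenvectors of the pullback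
([sum_of_eigenvectors]).  Contraction gives the eigenvalues positive valuation
([contracting_orbit_prod]).  Because the [P_j] generate, the linear parts of
these eigenvectors span, and among them one finds local coordinates
[U = (u, v)] with [u o h = alpha u] and [v o h = beta v].  An eigenvector of
eigenvalue [l], expanded in [u] and [v], involves only the monomials
[u^i v^j] with [alpha^i beta^j = l]; positivity of the valuations leaves
finitely many of them, so the eigenvector is a polynomial in [u] and [v]
([eigenvector_in_coordinates]).  Hence [K[x, y] = K[u, v]]: the local
coordinates form a polynomial automorphism of the plane, and it conjugates [h] to
[(x, y) |-> (alpha x, beta y)].

The relation.  If the numbers [alpha^i beta^j] are pairwise distinct, then
each [P_j], an eigenvector of a power of the pullback, is a single term
[c_j u^(e_j)] ([monomialP]).  The image of the embedding is then
parametrized by monomials, two of which are [u] and [v] up to nonzero constants;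
its tropicalization is the image of T^2 under an affine map that has a
continuous left inverse, so it is homeomorphic to T^2
([trop_monomial_image]).  This is excluded, so two of these numbers coincide, and
positivity of the valuations turns the coincidence into
[alpha^k = beta^l] with [k, l > 0] ([multiplicative_relation]). *)

(** * Order of vanishing at the origin and composition of power series *)
Section OrderAtOrigin.
Variable K : fieldType.

Definition ord_ge (n k : nat) (p : {mpoly K[n]}) : Prop :=
  forall e, (mdeg e < k)%N -> p@_e = 0.

Lemma ord_ge0 n (p : {mpoly K[n]}) : ord_ge 0 p.
Proof. by []. Qed.

Lemma ord_ge_zero n k : ord_ge k (0 : {mpoly K[n]}).
Proof. by move=> e _; rewrite mcoeff0. Qed.

Lemma ord_geW n k l (p : {mpoly K[n]}) : (l <= k)%N -> ord_ge k p -> ord_ge l p.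
Proof. by move=> lk pk e el; apply: pk; apply: leq_trans lk. Qed.

Lemma ord_geD n k (p q : {mpoly K[n]}) :
  ord_ge k p -> ord_ge k q -> ord_ge k (p + q).
Proof. by move=> pk qk e ek; rewrite mcoeffD pk // qk // addr0. Qed.

Lemma ord_geN n k (p : {mpoly K[n]}) : ord_ge k p -> ord_ge k (- p).
Proof. by move=> pk e ek; rewrite mcoeffN pk // oppr0. Qed.

Lemma ord_geB n k (p q : {mpoly K[n]}) :
  ord_ge k p -> ord_ge k q -> ord_ge k (p - q).
Proof. by move=> pk qk; apply/ord_geD/ord_geN. Qed.

Lemma ord_geZ n k c (p : {mpoly K[n]}) : ord_ge k p -> ord_ge k (c *: p).
Proof. by move=> pk e ek; rewrite mcoeffZ pk // mulr0. Qed.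

Lemma ord_geM n k l (p q : {mpoly K[n]}) :
  ord_ge k p -> ord_ge l q -> ord_ge (k + l) (p * q).
Proof.
move=> pk ql e ekl; rewrite mcoeffM big1 // => -[a b] /= /eqP eab.
have [ak|ka] := ltnP (mdeg a) k; first by rewrite pk // mul0r.
have abkl : (mdeg a + mdeg b < k + l)%N by rewrite -mdegD -eab.
by rewrite (ql b) ?mulr0 //; lia.
Qed.

Lemma ord_ge_eq0 n (p : {mpoly K[n]}) : (forall k, ord_ge k p) -> p = 0.
Proof. by move=> pk; apply/mpolyP => e; rewrite mcoeff0 (pk (mdeg e).+1). Qed.

Lemma ord_ge1P n (p : {mpoly K[n]}) : ord_ge 1 p <-> p@_0%MM = 0.
Proof.
split=> [->//|p0 e]; first by rewrite mdeg0.
by rewrite ltnS leqn0 mdeg_eq0 => /eqP ->.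
Qed.

(** Both polynomials have order at least [k] and they coincide up to [c] degrees
beyond.  Relative precision of this kind is what products preserve. *)
Definition agree n c k (p q : {mpoly K[n]}) : Prop :=
  [/\ ord_ge k p, ord_ge k q & ord_ge (k + c) (p - q)].

Lemma agreeM n c k l (p p' q q' : {mpoly K[n]}) :
  agree c k p p' -> agree c l q q' -> agree c (k + l) (p * q) (p' * q').
Proof.
move=> [pk pk' pp'] [ql ql' qq']; split; [exact: ord_geM|exact: ord_geM|].
have -> : p * q - p' * q' = (p - p') * q + p' * (q - q') by ring.
apply: ord_geD; last by rewrite -addnA; exact: ord_geM.
by rewrite addnAC; exact: ord_geM.
Qed.

Lemma agreeX n c k (p q : {mpoly K[n]}) :
  agree c 1 p q -> agree c k (p ^+ k) (q ^+ k).
Proof.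
move=> pq; elim: k => [|k IH]; last by rewrite !exprS; exact: (agreeM pq IH).
by rewrite !expr0; split=> //; rewrite subrr; exact: ord_ge_zero.
Qed.

Lemma agree_monomial n d c (e : 'X_{1..n}) (g g' : n.-tuple {mpoly K[d]}) :
  (forall i, agree c 1 (tnth g i) (tnth g' i)) ->
  agree c (mdeg e) ('X_[e] \mPo g) ('X_[e] \mPo g').
Proof.
move=> gg'; rewrite !comp_mpolyX mdegE.
apply: (big_ind3 (fun k p q => agree c k p q)).
- by split=> //; rewrite subrr; exact: ord_ge_zero.
- by move=> *; exact: agreeM.
- by move=> i _; exact/agreeX.
Qed.

Lemma ord_ge_sum n k (I : eqType) (r : seq I) (F : I -> {mpoly K[n]}) :
  (forall i, i \in r -> ord_ge k (F i)) -> ord_ge k (\sum_(i <- r) F i).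
Proof.
move=> Fk; rewrite big_seq; apply: (big_ind (@ord_ge n k)) => //.
- exact: ord_ge_zero.
- exact: ord_geD.
Qed.

(** Substituting tuples without constant term loses no relative precision: a
monomial of degree [t] is a product of [t] factors, each known to [c] degrees
beyond its leading one. *)
Lemma agree_comp n d c k (p : {mpoly K[n]}) (g g' : n.-tuple {mpoly K[d]}) :
  (forall i, agree c 1 (tnth g i) (tnth g' i)) -> ord_ge k p ->
  agree c k (p \mPo g) (p \mPo g').
Proof.
move=> gg' pk; rewrite !(comp_mpolyEX p).
have kp e : e \in msupp p -> (k <= mdeg e)%N.
  by rewrite mcoeff_msupp leqNgt; apply: contra => /pk ->.
split; last rewrite -sumrB; apply: ord_ge_sum => e /kp ke.
- by have [+ _ _] := agree_monomial e gg' => /(ord_geW ke); exact: ord_geZ.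
- by have [_ + _] := agree_monomial e gg' => /(ord_geW ke); exact: ord_geZ.
- rewrite -scalerBr; have [_ _ +] := agree_monomial e gg'.
  by move=> /(@ord_geW _ _ (k + c)%N); rewrite leq_add2r => /(_ ke); exact: ord_geZ.
Qed.

Lemma agree_refl n c k (p : {mpoly K[n]}) : ord_ge k p -> agree c k p p.
Proof. by move=> pk; split=> //; rewrite subrr; exact: ord_ge_zero. Qed.

Lemma ord_ge_comp n d k (p : {mpoly K[n]}) (g : n.-tuple {mpoly K[d]}) :
  (forall i, ord_ge 1 (tnth g i)) -> ord_ge k p -> ord_ge k (p \mPo g).
Proof.
move=> g1 pk.
by have [] := agree_comp (c := 0) (fun i => agree_refl _ (g1 i)) pk.
Qed.

(** The constant term of [p] cancels in the difference, so [p] may be taken of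
order 1; this gains the one degree that [agree_comp] would not give for a
polynomial of order 0. *)
Lemma comp_sub_ord n d k (p : {mpoly K[n]}) (g g' : n.-tuple {mpoly K[d]}) :
  (forall i, agree k 1 (tnth g i) (tnth g' i)) ->
  ord_ge k.+1 ((p \mPo g) - (p \mPo g')).
Proof.
move=> gg'; pose p0 := (p@_0%MM)%:MP_[n] : {mpoly K[n]}.
have p1 : ord_ge 1 (p - p0).
  by apply/ord_ge1P; rewrite mcoeffB mcoeffC eqxx mulr1 subrr.
have [_ _] := agree_comp gg' p1.
rewrite !comp_mpolyB !comp_mpolyC add1n.
by have -> : forall a b c : {mpoly K[d]}, a - b - (c - b) = a - c by move=> *; ring.
Qed.

Lemma comp_mpolyA n m d (p : {mpoly K[n]}) (g : n.-tuple {mpoly K[m]})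
    (f : m.-tuple {mpoly K[d]}) :
  (p \mPo g) \mPo f = p \mPo [tuple tnth g i \mPo f | i < n].
Proof.
rewrite (comp_mpolyEX p) (comp_mpolyEX p [tuple _ | _ < _]) raddf_sum /=.
apply: eq_bigr => e _; rewrite comp_mpolyZ; congr (_ *: _).
rewrite !comp_mpolyX rmorph_prod; apply: eq_bigr => i _.
by rewrite rmorphXn tnth_mktuple.
Qed.

Lemma mcoeff_truncate n k (a : 'X_{1..n} -> K) e :
  (truncate k a)@_e = if (mdeg e <= k)%N then a e else 0.
Proof.
case: leqP => [ek|ke]; first by rewrite mcoeff_mpoly.
rewrite /truncate raddf_sum /= big1 // => m _.
rewrite mcoeffZ mcoeffX; case: eqP => [me|_]; last by rewrite mulr0.
by move: ke; rewrite -me ltnNge -ltnS bmdeg.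
Qed.

Lemma truncateE n k (a : 'X_{1..n} -> K) e :
  (mdeg e <= k)%N -> (truncate k a)@_e = a e.
Proof. by move=> ek; rewrite mcoeff_truncate ek. Qed.

(** The truncation degree in the composition is immaterial once it reaches the
degree of the coefficient that is read off. *)
Lemma pseries_comp_poly d n m (g : polymap K n m) (f : pseries_map K d n) k j e :
  (forall l, f l 0%MM = 0) -> (mdeg e <= k)%N ->
  pseries_comp (pseries_of g) f j e =
  (tnth g j \mPo [tuple truncate k (f l) | l < n])@_e.
Proof.
move=> f0 ek; rewrite /pseries_comp /=.
set t := mdeg e; set q := truncate t _; set F := [tuple _ | _ < _].
set F' := [tuple truncate k _ | _ < _].
have F1 l : ord_ge 1 (tnth F l).
  by apply/ord_ge1P; rewrite tnth_mktuple truncateE ?mdeg0.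
have F1' l : ord_ge 1 (tnth F' l).
  by apply/ord_ge1P; rewrite tnth_mktuple truncateE ?mdeg0.
have FF' l : agree t 1 (tnth F l) (tnth F' l).
  split=> // e' et; rewrite !tnth_mktuple mcoeffB !truncateE ?subrr //; lia.
apply/eqP; rewrite -subr_eq0 -mcoeffB; apply/eqP.
have -> : (q \mPo F) - (tnth g j \mPo F') =
    ((q - tnth g j) \mPo F) + ((tnth g j \mPo F) - (tnth g j \mPo F')).
  by rewrite comp_mpolyB addrA subrK.
rewrite mcoeffD (comp_sub_ord _ FF') ?addr0 //.
apply: (@ord_ge_comp _ _ t.+1) => // e' et.
by rewrite mcoeffB truncateE ?subrr.
Qed.

Lemma pseries_comp_polymap d n m (g : polymap K n m) (f : polymap K d n) :
  (forall l, ord_ge 1 (tnth f l)) ->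
  pseries_comp (pseries_of g) (pseries_of f) = pseries_of (polymap_comp g f).
Proof.
move=> f1; apply/funext => j; apply/funext => e.
rewrite (@pseries_comp_poly _ _ _ g _ (mdeg e)) //; last first.
  by move=> l; apply/ord_ge1P/f1.
rewrite /pseries_of tnth_mktuple.
apply/eqP; rewrite -subr_eq0 -mcoeffB; apply/eqP.
apply: (@comp_sub_ord _ _ (mdeg e)) => // l; split=> //.
  by apply/ord_ge1P; rewrite tnth_mktuple truncateE ?mdeg0 //; exact/ord_ge1P.
by move=> e' et; rewrite tnth_mktuple mcoeffB truncateE ?subrr.
Qed.

(** A left inverse [r] of the comorphism recovers each coordinate as [r o i], so
the power series [f] equals the polynomial [r o g]. *)
Lemma lift_polynomial d n (i : polymap K d n) (f : pseries_map K d d)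
    (g : polymap K d n) :
  embedding i -> (forall j, ord_ge 1 (tnth i j)) -> (forall l, f l 0%MM = 0) ->
  pseries_comp (pseries_of i) f =2 pseries_of g ->
  exists h : polymap K d d, f = pseries_of h.
Proof.
move=> emb i1 f0 fg.
have /choice [r ri] : forall l : 'I_d, exists p, p \mPo i = 'X_l.
  by move=> l; exact: emb.
exists [tuple r l \mPo g | l < d]; apply/funext => l; apply/funext => e.
rewrite /pseries_of tnth_mktuple; set k := mdeg e.
pose t := [tuple truncate k (f l) | l < d].
have -> : f l e = ('X_l \mPo t)@_e.
  by rewrite comp_mpolyXU -tnth_nth tnth_mktuple truncateE.
rewrite -ri comp_mpolyA; apply/eqP; rewrite -subr_eq0 -mcoeffB; apply/eqP.
have ig j e' : (mdeg e' <= k)%N -> (tnth i j \mPo t)@_e' = (tnth g j)@_e'.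
  by move=> ek; rewrite -(pseries_comp_poly _ _ f0 ek) fg.
have t1 s : ord_ge 1 (tnth t s).
  by apply/ord_ge1P; rewrite tnth_mktuple truncateE ?mdeg0.
have it1 j : ord_ge 1 (tnth i j \mPo t) by apply: ord_ge_comp.
apply: (@comp_sub_ord _ _ k) => // j; rewrite tnth_mktuple; split=> //.
  by apply/ord_ge1P; rewrite -ig ?mdeg0 //; exact/ord_ge1P.
by move=> e' ek; rewrite mcoeffB ig ?subrr.
Qed.
End OrderAtOrigin.

(** * Sums of eigenvectors of an operator with scalar power *)
Section CyclicAveraging.
Variables (K : closedFieldType) (charK : [pchar K] =i pred0).

Lemma natr_neq0_pchar0 N : (0 < N)%N -> N%:R != 0 :> K.
Proof. by rewrite lt0n ((pcharf0P K).1 charK). Qed.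

Lemma prim_root_exists N : (0 < N)%N -> exists w : K, N.-primitive_root w.
Proof.
move=> N0; have [rs Ers] := closed_field_poly_normal ('X^N - 1 : {poly K}).
move: Ers; rewrite (monicP (monicXnsubC _ N0)) scale1r => Ers.
have urs : uniq rs.
  by rewrite -separable_prod_XsubC -Ers separable_Xn_sub_1 ?natr_neq0_pchar0.
have : has N.-primitive_root rs.
  apply: has_prim_root => //.
    apply/allP => x xrs; rewrite unity_rootE -subr_eq0.
    have : root ('X^N - 1) x by rewrite Ers root_prod_XsubC.
    by rewrite rootE !hornerE.
  by rewrite -ltnS -(size_prod_XsubC rs id) -Ers size_XnsubC.
by move=> /hasP[w _ ww]; exists w.
Qed.

Lemma sum_prim_root N (w : K) k : N.-primitive_root w -> (0 < k < N)%N ->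
  \sum_(s < N) (w ^+ s) ^- k = 0.
Proof.
move=> ww /andP[k0 kN]; have N0 := prim_order_gt0 ww.
have wk : w ^- k != 1.
  apply/eqP => /(congr1 (fun x => x^-1)); rewrite invrK invr1 => /eqP.
  by rewrite -(prim_order_dvd ww) => /(dvdn_leq k0); rewrite leqNgt kN.
have wkN : (w ^- k) ^+ N = 1.
  by rewrite exprVn exprAC (prim_expr_order ww) expr1n invr1.
have := subrX1 (w ^- k) N; rewrite wkN subrr => /esym/eqP.
rewrite mulf_eq0 subr_eq0 (negPf wk) /= => /eqP {2}<-.
by apply: eq_bigr => s _; rewrite exprVn exprAC.
Qed.

(** If [T^N] acts on [v] as the scalar [b], the averages
[N^-1 \sum_k mu^-k T^k v] over the [N] distinct roots [mu] of [X^N - b] are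
eigenvectors of [T], and they add up to [v] because the powers of a primitive
[N]-th root of unity sum to 0. *)
Lemma sum_of_eigenvectors (V : lmodType K) (T : {linear V -> V}) N (v : V) b :
  (0 < N)%N -> b != 0 -> iter N T v = b *: v ->
  exists (x : 'I_N -> V) (mu : 'I_N -> K),
    v = \sum_s x s /\ forall s, T (x s) = mu s *: x s /\ mu s ^+ N = b.
Proof.
move=> N0 b0 Tv.
have [w ww] := prim_root_exists N0.
have [z zN] : exists z : K, z ^+ N = b.
  have [z] := @solve_monicpoly K N (fun i => if i is 0%N then b else 0) N0.
  case: N N0 {Tv w ww} => // N _; rewrite big_ord_recl expr0 mulr1 big1 ?addr0.
    by exists z.
  by move=> i _; rewrite mul0r.
pose mu (s : 'I_N) := z * w ^+ s.
have muN s : mu s ^+ N = b.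
  by rewrite exprMn zN exprAC (prim_expr_order ww) expr1n mulr1.
have mu0 s : mu s != 0.
  by apply: contra_neq b0 => mus; rewrite -(muN s) mus expr0n gtn_eqF.
pose F s k := mu s ^- k *: iter k T v.
exists (fun s => N%:R^-1 *: \sum_(k < N) F s k), mu; split; last first.
  move=> s; split=> //; rewrite linearZ linear_sum /= scalerA mulrC -scalerA.
  congr (_ *: _).
  have TF k : T (F s k) = mu s *: F s k.+1.
    by rewrite linearZ /= /F scalerA exprS invfM mulrA divff ?mul1r.
  under eq_bigr => k _ do rewrite TF.
  rewrite -scaler_sumr; congr (_ *: _).
  (* the sum is cyclic: its terms of index N and 0 coincide *)
  have FN : F s N = F s 0%N.
    by rewrite /F Tv muN scalerA mulVf // expr0 invr1.
  move: FN; rewrite -(prednK N0) => FN.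
  by rewrite big_ord_recr big_ord_recl /= FN addrC.
rewrite -scaler_sumr exchange_big /=.
rewrite (bigD1 (Ordinal N0)) //= [X in _ + X]big1 ?addr0.
  have F0 s : F s 0%N = v by rewrite /F expr0 invr1 scale1r.
  rewrite (eq_bigr (fun=> v)) => [|s _]; last exact: F0.
  by rewrite sumr_const card_ord -scaler_nat scalerA mulVf ?natr_neq0_pchar0 ?scale1r.
(* the terms with k > 0 cancel when mu runs over the roots *)
move=> k k0; rewrite /F -scaler_suml.
have -> : \sum_(s < N) mu s ^- k = z ^- k * \sum_(s < N) (w ^+ s) ^- k.
  by rewrite mulr_sumr; apply: eq_bigr => s _; rewrite exprMn invfM.
rewrite sum_prim_root // ?mulr0 ?scale0r //.
by rewrite ltn_ord andbT lt0n; apply: contra k0 => /eqP k0; apply/eqP/val_inj.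
Qed.
End CyclicAveraging.

(** * Valuations *)
Section Valuation.
Variables (R : realType) (K : fieldType) (nu : K -> \bar R) (nuP : valuation nu).

Lemma val_neqNy a : nu a != -oo%E. Proof. by case: nuP. Qed.
Lemma val0 : nu 0 = +oo%E. Proof. by case: nuP => _ /(_ 0)[_ ->]. Qed.
Lemma val_eqy a : (nu a == +oo%E) = (a == 0).
Proof. by case: nuP => _ /(_ a) h _ _ _; apply/eqP/eqP => /h. Qed.
Lemma valM a b : nu (a * b) = (nu a + nu b)%E. Proof. by case: nuP. Qed.
Lemma val_surj (r : R) : exists a, nu a = r%:E. Proof. by case: nuP. Qed.

Lemma val_fin a : a != 0 -> exists r : R, nu a = r%:E.
Proof.
rewrite -val_eqy; case: (nu a) (val_neqNy a) => [r _ _| |] //.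
by exists r.
Qed.

Lemma val1 : nu 1 = 0%E.
Proof.
have [r r1] := val_fin (oner_neq0 K).
have := valM 1 1; rewrite mulr1 r1 -EFinD => -[] /eqP.
by rewrite -subr_eq0 opprD addNKr oppr_eq0 => /eqP ->.
Qed.

Lemma valX a k : nu (a ^+ k) = (nu a *+ k)%E.
Proof.
elim: k => [|k IH]; first by rewrite expr0 val1.
by rewrite exprS valM IH muleS.
Qed.

Lemma val_prod (I : Type) (r : seq I) (F : I -> K) :
  nu (\prod_(i <- r) F i) = (\sum_(i <- r) nu (F i))%E.
Proof. exact: (big_morph nu valM val1). Qed.
End Valuation.

(** * Eigenvectors are polynomials in eigencoordinates *)
Section Linearization.
Variables (K : fieldType) (d : nat).

Definition mon (lam : 'I_d -> K) (e : 'X_{1..d}) : K := \prod_i lam i ^+ e i.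

Definition scaling_map (lam : 'I_d -> K) : polymap K d d := [tuple lam i *: 'X_i | i < d].

Lemma mcoeff_comp_scaling_map lam (p : {mpoly K[d]}) e :
  (p \mPo scaling_map lam)@_e = mon lam e * p@_e.
Proof.
rewrite comp_mpolyEX raddf_sum /= [in RHS](mpolyE p) raddf_sum /= mulr_sumr.
apply: eq_bigr => m _; rewrite !mcoeffZ mulrCA; congr (_ * _).
have -> : 'X_[m] \mPo scaling_map lam = mon lam m *: 'X_[m].
  rewrite comp_mpolyX /mon [in RHS]mpolyXE_id -scaler_prod; apply: eq_bigr => i _.
  by rewrite tnth_mktuple exprZn.
by rewrite mcoeffZ mcoeffX; case: eqP => [->|_] //; rewrite !mulr0.
Qed.

(* V inverts U to first order only: this suffices to compare leading forms, and
   it is all that is known of U before it is shown to be an automorphism. *)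
Variables (U V : polymap K d d).
Hypothesis (U1 : forall j, ord_ge 1 (tnth U j)).
Hypothesis (V1 : forall j, ord_ge 1 (tnth V j)).
Hypothesis (UV : forall j, ord_ge 2 ((tnth U j \mPo V) - 'X_j)).
Hypothesis (VU : forall j, ord_ge 2 ((tnth V j \mPo U) - 'X_j)).

Let X1 (j : 'I_d) : ord_ge 1 ('X_j : {mpoly K[d]}).
Proof. by apply/ord_ge1P; rewrite mcoeffX mnm1_eq0. Qed.

Lemma comp_approximate_inverse k (p : {mpoly K[d]}) (A B : polymap K d d) :
  (forall j, ord_ge 1 (tnth A j)) -> (forall j, ord_ge 1 (tnth B j)) ->
  (forall j, ord_ge 2 ((tnth A j \mPo B) - 'X_j)) -> ord_ge k p ->
  ord_ge k.+1 (((p \mPo A) \mPo B) - p).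
Proof.
move=> A1 B1 AB pk; rewrite comp_mpolyA -[X in _ - X]comp_mpoly_id.
have gg j : agree 1 1 (tnth [tuple tnth A i \mPo B | i < d] j)
                      (tnth [tuple 'X_i | i < d] j).
  by rewrite !tnth_mktuple; split=> //; exact: ord_ge_comp.
by have [_ _] := agree_comp gg pk; rewrite addn1.
Qed.

Lemma ord_ge_compU k (q : {mpoly K[d]}) :
  ord_ge k q -> ord_ge k.+1 (q \mPo U) -> ord_ge k.+1 q.
Proof.
move=> qk qUk; rewrite -[q](subKr ((q \mPo U) \mPo V)).
by apply: ord_geB; [exact: ord_ge_comp|exact: comp_approximate_inverse].
Qed.

(** The leading form of [q] can be read off that of [q o U]. *)
Lemma coordinates_independent (q : {mpoly K[d]}) : q \mPo U = 0 -> q = 0.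
Proof.
move=> qU; apply: ord_ge_eq0; elim=> [|k IH]; first exact: ord_ge0.
by apply: ord_ge_compU => //; rewrite qU; exact: ord_ge_zero.
Qed.

Variables (h : polymap K d d) (lam : 'I_d -> K).
Hypothesis h1 : forall j, ord_ge 1 (tnth h j).
Hypothesis Uh : forall j, tnth U j \mPo h = lam j *: tnth U j.

Lemma comp_U_h (q : {mpoly K[d]}) :
  (q \mPo U) \mPo h = (q \mPo scaling_map lam) \mPo U.
Proof.
rewrite !comp_mpolyA; apply: (congr1 (fun g => comp_mpoly g q)).
apply: eq_from_tnth => j.
by rewrite !tnth_mktuple Uh comp_mpolyZ comp_mpolyXU -tnth_nth.
Qed.

Lemma eigenvector_coeff l (q : {mpoly K[d]}) e :
  (q \mPo U) \mPo h = l *: (q \mPo U) -> mon lam e * q@_e = l * q@_e.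
Proof.
rewrite comp_U_h -comp_mpolyZ => /eqP; rewrite -subr_eq0 -comp_mpolyB => /eqP.
by move=> /coordinates_independent/eqP; rewrite subr_eq0 => /eqP/(congr1 (mcoeff e));
   rewrite mcoeff_comp_scaling_map mcoeffZ.
Qed.

(** The leading form of an eigenvector is the leading form of a polynomial in the
eigencoordinates [U] with the same eigenvalue: with [q := p o V], the
polynomials [p] and [q o U] agree to leading order, and comparing the leading
forms of [p o h = l p] gives [lam^e q_e = l q_e] for the monomials of
degree [k]. *)
Lemma eigenvector_leading_part l k (p : {mpoly K[d]}) :
  p \mPo h = l *: p -> ord_ge k p ->
  exists q : {mpoly K[d]}, [/\ (q \mPo U) \mPo h = l *: (q \mPo U),
    (forall e, q@_e != 0 -> mdeg e = k) & ord_ge k.+1 (p - (q \mPo U))].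
Proof.
move=> ph pk; pose q := p \mPo V.
have qk : ord_ge k q by exact: ord_ge_comp.
have pqU : ord_ge k.+1 (p - (q \mPo U)).
  by rewrite -opprB; apply/ord_geN/comp_approximate_inverse.
have lamq e : mdeg e = k -> mon lam e * q@_e = l * q@_e.
  move=> ek; apply/eqP; rewrite -subr_eq0 -mcoeff_comp_scaling_map -mcoeffZ -mcoeffB.
  apply/eqP; apply: (@ord_ge_compU k); rewrite ?ek //.
    apply: ord_geB; last exact: ord_geZ.
    by move=> e' e'k; rewrite mcoeff_comp_scaling_map qk // mulr0.
  rewrite comp_mpolyB comp_mpolyZ -comp_U_h.
  have -> : ((q \mPo U) \mPo h) - l *: (q \mPo U) =
            l *: (p - (q \mPo U)) - ((p - (q \mPo U)) \mPo h).
    have E (a b c : {mpoly K[d]}) : a - b = c - b - (c - a) by ring.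
    by rewrite comp_mpolyB ph scalerBr; exact: E.
  by apply: ord_geB; [exact: ord_geZ|exact: ord_ge_comp].
pose q0 := truncate k (fun e => q@_e).
have q0E e : q0@_e = if mdeg e == k then q@_e else 0.
  rewrite mcoeff_truncate; case: ltngtP => // ek; exact: qk.
exists q0; split.
- rewrite comp_U_h -comp_mpolyZ; apply: (congr1 (comp_mpoly U)).
  apply/mpolyP => e.
  rewrite mcoeff_comp_scaling_map mcoeffZ q0E; case: eqP => [/lamq //|_].
  by rewrite !mulr0.
- by move=> e; rewrite q0E; case: (mdeg e =P k) => // _; rewrite eqxx.
- have -> : p - (q0 \mPo U) = (p - (q \mPo U)) + ((q - q0) \mPo U).
    by rewrite comp_mpolyB addrA addrNK.
  apply: ord_geD => //; apply: ord_ge_comp => // e; rewrite ltnS => ek.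
  rewrite mcoeffB q0E; case: eqP => [_|/eqP]; first by rewrite subrr.
  by move=> nek; rewrite qk ?subr0 // ltn_neqAle nek.
Qed.

(** Leading parts are split off degree by degree.  From degree [B] on no monomial has
eigenvalue [l], so the process stops with a remainder of infinite order. *)
Lemma eigenvector_in_coordinates l B (p : {mpoly K[d]}) :
  (forall e, mon lam e = l -> (mdeg e < B)%N) ->
  p \mPo h = l *: p -> exists q, p = q \mPo U.
Proof.
move=> lB ph; suff descent k : ord_ge (B - k) p -> exists q, p = q \mPo U.
  by apply: (descent B); rewrite subnn; exact: ord_ge0.
elim: k p ph => [|k IH] p ph.
  rewrite subn0 => pB; exists 0; rewrite comp_mpoly0; apply: ord_ge_eq0.
  elim=> [//|k pk]; have [kB|Bk] := ltnP k B; first exact: ord_geW pB.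
  have [q [qh qk]] := eigenvector_leading_part ph pk.
  suff -> : q = 0 by rewrite comp_mpoly0 subr0.
  apply/mpolyP => e; rewrite mcoeff0; apply/eqP/negPn/negP => qe.
  have := eigenvector_coeff e qh => /(mulIf qe)/lB.
  by rewrite (qk _ qe) ltnNge Bk.
have [kB|Bk] := ltnP k B; last first.
  by move=> _; apply: IH => //; rewrite (eqP Bk); exact: ord_ge0.
move=> pk; have [q [qh _ pq]] := eigenvector_leading_part ph pk.
have [||q' q'E] := IH (p - (q \mPo U)).
- by rewrite comp_mpolyB ph qh scalerBr.
- by rewrite subnSK in pq.
by exists (q' + q); rewrite comp_mpolyD -q'E addrNK.
Qed.
End Linearization.

(** * Linear parts and the choice of local coordinates *)
Section LinearPart.
Variable K : fieldType.

Lemma ord_ge2P n (p : {mpoly K[n]}) :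
  ord_ge 2 p <-> p@_0%MM = 0 /\ forall l, p@_U_(l) = 0.
Proof.
split=> [p2|[p0 p1] e]; first by split=> [|l]; apply: p2; rewrite ?mdeg0 ?mdeg1.
rewrite ltnS leq_eqVlt ltnS leqn0 => /orP[|].
  by move=> /mdeg1P[l /eqP ->].
by rewrite mdeg_eq0 => /eqP ->.
Qed.

Lemma linear_part_comp n d (p : {mpoly K[n]}) (g : polymap K d n) l :
  (forall j, ord_ge 1 (tnth g j)) ->
  (p \mPo g)@_U_(l) = \sum_j p@_U_(j) * (tnth g j)@_U_(l).
Proof.
move=> g1; pose q := p - (p@_0%MM)%:MP - \sum_j p@_U_(j) *: 'X_j.
have q2 : ord_ge 2 q.
  apply/ord_ge2P; split=> [|k]; rewrite /q !mcoeffB mcoeffC raddf_sum /=.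
    rewrite eqxx mulr1 subrr big1 ?subrr // => j _.
    by rewrite mcoeffZ mcoeffX mnm1_eq0 mulr0.
  rewrite mnm1_eq0 mulr0 subr0 (bigD1 k) //= mcoeffZ mcoeffXU eqxx mulr1.
  rewrite big1 ?addr0 ?subrr // => j jk.
  by rewrite mcoeffZ mcoeffXU (negPf jk) mulr0.
have pE : p = q + ((p@_0%MM)%:MP + \sum_j p@_U_(j) *: 'X_j)
  by rewrite /q; ring.
clearbody q.
rewrite [in LHS]pE !comp_mpolyD !mcoeffD (ord_ge_comp g1 q2) ?mdeg1 // add0r.
rewrite comp_mpolyC mcoeffC mnm1_eq0 mulr0 add0r (raddf_sum (comp_mpoly g)) raddf_sum /=.
by apply: eq_bigr => j _; rewrite comp_mpolyZ comp_mpolyXU -tnth_nth mcoeffZ.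
Qed.

Lemma approximate_inverse d (U : polymap K d d) (J : 'M[K]_d) :
  (forall j, ord_ge 1 (tnth U j)) ->
  (forall j l, (tnth U j)@_U_(l) = J j l) -> J \in unitmx ->
  exists V : polymap K d d, [/\ forall j, ord_ge 1 (tnth V j),
    forall j, ord_ge 2 ((tnth U j \mPo V) - 'X_j) &
    forall j, ord_ge 2 ((tnth V j \mPo U) - 'X_j)].
Proof.
move=> U1 UJ Ju; pose V : polymap K d d :=
  [tuple \sum_l invmx J j l *: 'X_l | j < d].
have V0 j : (tnth V j)@_0%MM = 0.
  rewrite tnth_mktuple raddf_sum big1 //= => l _.
  by rewrite mcoeffZ mcoeffX mnm1_eq0 mulr0.
have VJ j l : (tnth V j)@_U_(l) = invmx J j l.
  rewrite tnth_mktuple raddf_sum (bigD1 l) //= big1 ?addr0.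
    by rewrite mcoeffZ mcoeffXU eqxx mulr1.
  by move=> k kl; rewrite mcoeffZ mcoeffXU (negPf kl) mulr0.
have V1 j : ord_ge 1 (tnth V j) by exact/ord_ge1P.
exists V; split=> // j; apply/ord_ge2P; split=> [|l].
- by rewrite mcoeffB mcoeffX mnm1_eq0 subr0; apply/ord_ge1P/ord_ge_comp.
- rewrite mcoeffB linear_part_comp // mcoeffXU.
  under eq_bigr => k _ do rewrite UJ VJ.
  have := congr1 (fun A : 'M_d => A j l) (mulmxV Ju).
  by rewrite !mxE => ->; rewrite subrr.
- by rewrite mcoeffB mcoeffX mnm1_eq0 subr0; apply/ord_ge1P/ord_ge_comp.
- rewrite mcoeffB linear_part_comp // mcoeffXU.
  under eq_bigr => k _ do rewrite UJ VJ.
  have := congr1 (fun A : 'M_d => A j l) (mulVmx Ju).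
  by rewrite !mxE => ->; rewrite subrr.
Qed.

(** The hypothesis says that the linear parts of the [E i] span all linear forms;
[d] of them then form a basis, and the inverse of their matrix gives [V]. *)
Lemma choose_coordinates m d (E : 'I_m -> {mpoly K[d]}) :
  (forall j, ord_ge 1 (E j)) ->
  (forall k, exists c : 'I_m -> K, forall l,
     \sum_i c i * (E i)@_U_(l) = (k == l)%:R) ->
  exists (s : 'I_d -> 'I_m) (V : polymap K d d), let U := [tuple E (s k) | k < d] in
   [/\ forall j, ord_ge 1 (tnth V j),
    forall j, ord_ge 2 ((tnth U j \mPo V) - 'X_j) &
    forall j, ord_ge 2 ((tnth V j \mPo U) - 'X_j)].
Proof.
move=> E1 /choice[c cE]; pose L := \matrix_(i < m, l < d) (E i)@_U_(l).
have cL : (\matrix_(k, i) c k i) *m L = 1%:M.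
  apply/matrixP => k l; rewrite !mxE -cE.
  by apply: eq_bigr => i _; rewrite !mxE.
have fL : row_full L by apply/row_fullP; exists (\matrix_(k, i) c k i).
pose s := fullrankfun fL.
exists s; apply: (@approximate_inverse _ _ (rowsub s L)).
- by move=> j; rewrite tnth_mktuple.
- by move=> j l; rewrite tnth_mktuple !mxE.
- exact: fullrowsub_unit.
Qed.
End LinearPart.

(** * Polynomials with a linear tropicalization *)
Section TropicalMonomial.
Variables (R : realType) (K : fieldType) (nu : K -> \bar R) (nuP : valuation nu).

Lemma affine_le_slope (a b c r : R) :
  (forall t, a * t + c <= b * t + r) -> a = b.
Proof.
move=> h; apply/eqP; rewrite -subr_eq0; apply/negPn/negP => ab.
have := h ((r - c + 1) / (a - b)).
rewrite -subr_ge0.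
have -> : b * ((r - c + 1) / (a - b)) + r - (a * ((r - c + 1) / (a - b)) + c)
        = -1 by field.
by rewrite ler0N1.
Qed.

(** Along every coordinate axis each tropical monomial of [p] is an affine
function that bounds [x_j + c] from above on a whole line, so it has the
same slope. *)
Lemma trop_linear_form n (p : {mpoly K[n]}) j (c : R) :
  (forall x, Tspace R n x -> teval (trop_poly nu p) x = (x ord0 j + c%:E)%E) ->
  exists2 a, a != 0 & p = a *: 'X_j.
Proof.
move=> pE.
have suppP e : e \in msupp p -> e = U_(j)%MM.
  move=> ep; apply/mnmP => l; rewrite mnm1E.
  have [r re] : exists r : R, nu p@_e = r%:E.
    by apply: val_fin => //; rewrite -mcoeff_msupp.
  have slope (t : R) : (l == j)%:R * t + c <= (e l)%:R * t + r.
    pose x : 'rV[\bar R]_n := \row_k (if k == l then t else 0)%:E.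
    have xT : Tspace R n x by move=> k; rewrite mxE.
    have le_e : (teval (trop_poly nu p) x <= (r + t * (e l)%:R)%:E)%E.
      have -> : (r + t * (e l)%:R)%:E = (nu p@_e + \sum_k x ord0 k *+ e k)%E.
        rewrite re (bigD1 l) //= big1 ?adde0 => [|k kl].
          by rewrite mxE eqxx -EFin_natmul -EFinD mulr_natr.
        by rewrite mxE (negPf kl) -EFin_natmul mul0rn.
      apply: (@ge_bigmin_seq _ _ _ _ _ (nu p@_e, e) xpredT
                (fun c : \bar R * 'X_{1..n} => (c.1 + \sum_k x ord0 k *+ c.2 k)%E)) => //.
      by apply: map_f.
    move: le_e; rewrite pE // mxE -EFinD lee_fin (eq_sym j l).
    by case: (l == j) => /=; lra.
  have := affine_le_slope slope.
  by move/eqP; rewrite eqr_nat eq_sym => /eqP ->; rewrite eq_sym.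
have pEj : p = p@_U_(j) *: 'X_j.
  apply/mpolyP => e; rewrite mcoeffZ mcoeffX.
  case: eqP => [<-|ej]; first by rewrite mulr1.
  rewrite mulr0; apply/eqP; rewrite mcoeff_eq0; apply/negP => /suppP ee.
  by rewrite ee in ej.
exists (p@_U_(j)) => //; apply/eqP => a0.
have p0 : p = 0 by rewrite pEj a0 scale0r.
have xT : Tspace R n (const_mx 0%E) by move=> k; rewrite mxE.
have := pE _ xT; rewrite p0 /trop_poly msupp0 /teval big_nil mxE -EFinD => E.
by have := ltry (0 + c); rewrite -E.
Qed.
End TropicalMonomial.

(** * Tropical monomial maps are closed embeddings *)
Section MatrixTopology.
Variables (m n : nat) (T : topologicalType).

Lemma mx_coord_continuous i j : continuous (fun M : 'M[T]_(m, n) => M i j).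
Proof.
move=> M A /= nA; exists (fun i' j' => [set t | (i', j') = (i, j) -> A t]).
  move=> i' j'; have [[-> ->]|ij] := pselect ((i', j') = (i, j)).
    by apply: filterS nA => t At.
  by apply: filterS (filterT : nbhs _ setT) => t _ /ij.
by move=> N /(_ i j); exact.
Qed.

Lemma cvg_mx (S : Type) (F : set_system S) (FF : Filter F)
    (f : S -> 'M[T]_(m, n)) (M : 'M[T]_(m, n)) :
  (forall i j, (fun s => f s i j) @ F --> M i j) -> f @ F --> M.
Proof.
move=> fM A [P PM PA]; apply: (filterS (P := [set s | forall i j, P i j (f s i j)])).
  by move=> s; exact: PA.
have : F [set s | forall ij : 'I_m * 'I_n, P ij.1 ij.2 (f s ij.1 ij.2)].
  by apply: filter_forall => -[i j]; apply: fM; exact: PM.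
by apply: filterS => s Ps i j; exact: (Ps (i, j)).
Qed.

Lemma mx_hausdorff : hausdorff_space T -> hausdorff_space 'M[T]_(m, n).
Proof.
move=> hT p q pq; apply/matrixP => i j; apply: hT => A B nA nB.
have [M [AM BM]] := pq _ _ (@mx_coord_continuous i j p A nA)
                           (@mx_coord_continuous i j q B nB).
by exists (M i j).
Qed.
End MatrixTopology.

(** The image of a section [g] is where [g o f] is the identity, hence it contains
its limit points at which [f] takes a value in the domain of [g]. *)
Lemma closure_section (S T : topologicalType) (B : set T) (g : T -> S)
    (f : S -> T) (x : S) :
  hausdorff_space S -> (forall y, B y -> f (g y) = y) ->
  closure (g @` B) x -> B (f x) ->
  {for x, continuous f} -> {for f x, continuous g} -> (g @` B) x.
Proof.
move=> hS fg cx Bfx fc gc; exists (f x) => //; set A := g @` B in cx.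
have PF : ProperFilter (within A (nbhs x)) by exact: within_nbhs_proper.
apply: (cvg_unique hS (F := within A (nbhs x))); last exact: cvg_within.
move=> W /gc/fc nW; apply: (@filterS _ (nbhs x) _ _ _ _ nW) => t Wt [y By yt].
by move: Wt; rewrite /= -yt fg.
Qed.

Section TropicalMonomialMap.
Variables (R : realType) (d n : nat) (c : 'I_n -> \bar R) (e : 'I_n -> 'X_{1..d}).

Definition tmonomial_map (y : 'rV[\bar R]_d) : 'rV[\bar R]_n :=
  \row_j (c j + \sum_k y ord0 k *+ e j k)%E.

Hypothesis cT : forall j, c j != -oo%E.
Variables (J : 'I_d -> 'I_n) (r : 'I_d -> R).
Hypothesis (eJ : forall k, e (J k) = U_(k)%MM) (cJ : forall k, c (J k) = (r k)%:E).

Let mulT (a : \bar R) k : a != -oo%E -> (a *+ k)%E != -oo%E.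
Proof.
move=> aT; elim: k => [|k IH]; first by [].
by rewrite muleS adde_eq_ninfty negb_or aT.
Qed.

Let sumT (y : 'rV[\bar R]_d) j : Tspace R d y ->
  (\sum_k y ord0 k *+ e j k)%E != -oo%E.
Proof.
move=> yT; apply: (big_ind (fun a : \bar R => a != -oo%E)) => //.
- by move=> a b aT bT; rewrite adde_eq_ninfty negb_or aT.
- by move=> k _; exact: mulT.
Qed.

Lemma tmonomial_map_Tspace y : Tspace R d y -> Tspace R n (tmonomial_map y).
Proof. by move=> yT j; rewrite mxE adde_eq_ninfty negb_or cT sumT. Qed.

Let def_ (a b : \bar R) : a != -oo%E -> b != -oo%E -> (a +? b)%E.
Proof. by case: a => [a| |]; case: b => [b| |]. Qed.

Let cvg_combination (S : Type) (F : set_system S) (FF : Filter F)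
    (u : 'I_d -> S -> \bar R) (y : 'rV[\bar R]_d) j : Tspace R d y ->
  (forall k, u k @ F --> y ord0 k) ->
  (\sum_k u k s *+ e j k)%E @[s --> F] --> (\sum_k y ord0 k *+ e j k)%E.
Proof.
move=> yT uy.
have mulk k l : (u k s *+ l)%E @[s --> F] --> (y ord0 k *+ l)%E.
  elim: l => [|l IH]; first exact: cvg_cst.
  under eq_fun => s do rewrite muleS.
  rewrite muleS; apply: cvgeD => //.
  by apply: def_ => //; exact: mulT.
elim: (index_enum _) => [|k r' IH].
  by under eq_fun => s do rewrite big_nil; rewrite big_nil; exact: cvg_cst.
under eq_fun => s do rewrite big_cons.
rewrite big_cons; apply: cvgeD => //; apply: def_; first exact: mulT.
apply: (big_ind (fun a : \bar R => a != -oo%E)) => //.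
- by move=> a b aT bT; rewrite adde_eq_ninfty negb_or aT.
- by move=> l _; exact: mulT.
Qed.

Lemma tmonomial_map_continuous y :
  Tspace R d y -> {for y, continuous tmonomial_map}.
Proof.
move=> yT; apply: (cvg_mx (nbhs_filter y)) => i j; rewrite ord1 mxE.
under eq_fun => z do rewrite mxE.
apply: (@cvgeD _ _ (nbhs_filter y)).
- exact/def_/sumT.
- exact: (@cvg_cst _ _ _ _ (nbhs_filter y)).
- apply: (cvg_combination (nbhs_filter y)) => // k.
  exact: mx_coord_continuous.
Qed.

Let coords (x : 'rV[\bar R]_n) : 'rV[\bar R]_d := \row_k (x ord0 (J k) - (r k)%:E)%E.

Let coordsK y : Tspace R d y -> coords (tmonomial_map y) = y.
Proof.
move=> yT; apply/rowP => k; rewrite !mxE eJ cJ (bigD1 k) //= big1 => [|l lk].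
  by rewrite mnm1E eqxx adde0 EFinN [((r k)%:E + _)%E]addeC addeK.
by rewrite mnm1E eq_sym (negPf lk).
Qed.

(** The coordinates [J k], where the map is a translate of the [k]-th variable, give a
continuous left inverse of the monomial map. *)
Lemma homeomorphic_tmonomial_image :
  homeomorphic (tclosure (tmonomial_map @` Tspace R d)) (Tspace R d).
Proof.
have coordsT x : Tspace R n x -> Tspace R d (coords x).
  by move=> xT k; rewrite mxE adde_eq_ninfty negb_or xT.
have coordsC x : Tspace R n x -> {for x, continuous coords}.
  move=> xT; apply: (cvg_mx (nbhs_filter x)) => i j; rewrite ord1 mxE.
  under eq_fun => z do rewrite mxE.
  apply: (@cvgeD _ _ (nbhs_filter x)); [exact: def_|exact: mx_coord_continuous|].
  exact: (@cvg_cst _ _ _ _ (nbhs_filter x)).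
have closed_image : tclosure (tmonomial_map @` Tspace R d) = tmonomial_map @` Tspace R d.
  apply/seteqP; split=> [x [cx xT]|_ [y yT <-]]; last first.
    by split; [apply: subset_closure; exists y|exact: tmonomial_map_Tspace].
  apply: (closure_section _ coordsK cx (coordsT _ xT) (coordsC _ xT)).
  - exact/mx_hausdorff/ereal_hausdorff.
  - exact/tmonomial_map_continuous/coordsT.
rewrite closed_image; exists coords, tmonomial_map; split.
- by move=> _ [_ [y yT <-] <-]; rewrite coordsK.
- by [].
- apply: continuous_in_subspaceT => x; rewrite inE => -[y yT <-].
  exact/coordsC/tmonomial_map_Tspace.
- apply: continuous_in_subspaceT => y; rewrite inE.
  exact: tmonomial_map_continuous.
- split=> [_ [y yT <-]|y yT]; last exact: coordsK.
  by rewrite coordsK.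
Qed.
End TropicalMonomialMap.

(** * Iterates and eigenvalues of monomial maps *)
Section MonomialMaps.
Variables (K : fieldType) (n : nat) (sigma : 'S_n) (a : 'I_n -> K).

(** The coefficient of the [k]-th iterate of [x_j |-> a_j x_(sigma j)]. *)
Definition orbit_prod k j := \prod_(s < k) a ((sigma ^+ s)%g j).

Let orbit_prodS k j : orbit_prod k.+1 j = orbit_prod k j * a ((sigma ^+ k)%g j).
Proof. by rewrite /orbit_prod big_ord_recr. Qed.

Let permX k j : sigma ((sigma ^+ k)%g j) = (sigma ^+ k.+1)%g j.
Proof. by rewrite expgSr permM. Qed.

Variable FK : polymap K n n.
Hypothesis FKE : forall j, tnth FK j = a j *: 'X_(sigma j).

Lemma iter_monomial_map k x j :
  (iter k (polymap_eval FK) x) ord0 j = orbit_prod k j * x ord0 ((sigma ^+ k)%g j).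
Proof.
elim: k x => [|k IH] x; first by rewrite /orbit_prod big_ord0 mul1r expg0 perm1.
rewrite iterSr IH mxE FKE mevalZ mevalXU permX orbit_prodS mulrA //.
Qed.

Lemma iter_pullback (V : lmodType K) (T : {linear V -> V}) (P : 'I_n -> V) k j :
  (forall j, T (P j) = a j *: P (sigma j)) ->
  iter k T (P j) = orbit_prod k j *: P ((sigma ^+ k)%g j).
Proof.
move=> TP; elim: k => [|k IH]; first by rewrite /orbit_prod big_ord0 scale1r expg0 perm1.
by rewrite iterS IH linearZ /= TP scalerA permX orbit_prodS.
Qed.

Variables (R : realType) (nu : K -> \bar R) (nuP : valuation nu).

(** The [N]-th iterate, [N] the order of [sigma], is diagonal, and its powers
move the points of a ball arbitrarily close to 0. *)
Lemma contracting_orbit_prod j :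
  (forall j, a j != 0) -> contracting nu FK -> (0 < nu (orbit_prod #[sigma]%g j))%E.
Proof.
move=> a0 /(_ 0)[W [_ [s sW] _ Wit]].
set N := #[sigma]%g; set b := orbit_prod N j.
have [r rb] : exists r : R, nu b = r%:E.
  by apply: val_fin => //; apply/prodf_neq0 => i _.
have [t nut] := val_surj nuP (s + 1).
have [M MP] := Wit (s + 1).
have Wt : W (const_mx t).
  by apply: sW => k; rewrite mxE nut lte_fin ltrDl.
(* a multiple of N, so that the iterate is diagonal; positive even when M = 0 *)
have NM : (M <= M.+1 * N)%N.
  by apply: leq_trans (leq_pmulr _ (order_gt0 _)) => //.
have /(_ j) := MP _ NM _ (imageP _ Wt).
rewrite iter_monomial_map mxE.
have -> : orbit_prod (M.+1 * N) j = b ^+ M.+1.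
  elim: {+}M.+1 => [|m IH]; first by rewrite /orbit_prod mul0n big_ord0.
  rewrite exprSr mulSnr -IH /orbit_prod big_split_ord /=; congr (_ * _).
  apply: eq_bigr => i _; congr (a _).
  by rewrite expgD mulnC expgM expg_order expg1n mul1g.
rewrite valM // valX // rb nut -EFin_natmul -EFinD !lte_fin ltrDr.
by rewrite pmulrn_lgt0.
Qed.
End MonomialMaps.

Section Monomials.
Variables (R : realType) (K : fieldType) (nu : K -> \bar R) (nuP : valuation nu).
Variables (d : nat) (lam : 'I_d -> K) (v : 'I_d -> R).
Hypothesis nulam : forall i, nu (lam i) = (v i)%:E.

Lemma val_mon e : nu (mon lam e) = (\sum_i v i *+ e i)%:E.
Proof.
rewrite /mon val_prod // -sumEFin; apply: eq_bigr => i _.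
by rewrite valX // nulam EFin_natmul.
Qed.

Lemma monX e N : mon lam (e *+ N)%MM = mon lam e ^+ N.
Proof.
by rewrite /mon -prodrXl; apply: eq_bigr => i _; rewrite mulmnE exprM.
Qed.

(** [nu (lam^e)] is at least [mdeg e] times the least of the valuations
[v i]. *)
Lemma mon_degree_bounded l : (forall i, 0 < v i) -> l != 0 ->
  exists B, forall e, mon lam e = l -> (mdeg e < B)%N.
Proof.
move=> v0 /(val_fin nuP)[r rl].
pose delta := \big[Num.min/1]_i v i.
have d0 : 0 < delta by apply: lt_bigmin.
exists (Num.bound (r / delta)) => e el.
have := val_mon e; rewrite el rl => -[rE].
have dr : delta * (mdeg e)%:R <= r.
  rewrite rE mdegE natr_sum mulr_sumr; apply: ler_sum => i _.
  by rewrite -[leRHS]mulr_natr ler_wpM2r // bigmin_le.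
rewrite -(ltr_nat R); apply: le_lt_trans (archi_boundP _).
  by rewrite ler_pdivlMr // mulrC.
by apply: divr_ge0; [apply: le_trans dr; rewrite mulr_ge0 // ltW|exact: ltW].
Qed.
End Monomials.

(** * Polynomial linearization *)
Section Linearize.
Variables (R : realType) (K : closedFieldType) (charK : [pchar K] =i pred0).
Variables (nu : K -> \bar R) (nuP : valuation nu).

Lemma constant_part_comp n d (p : {mpoly K[n]}) (g : polymap K d n) :
  (forall j, ord_ge 1 (tnth g j)) -> (p \mPo g)@_0%MM = p@_0%MM.
Proof.
move=> g1; have p1 : ord_ge 1 (p - (p@_0%MM)%:MP).
  by apply/ord_ge1P; rewrite mcoeffB mcoeffC eqxx mulr1 subrr.
have := ord_ge_comp g1 p1 => /ord_ge1P.
rewrite comp_mpolyB comp_mpolyC mcoeffB mcoeffC eqxx mulr1 => /eqP.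
by rewrite subr_eq0 => /eqP.
Qed.

(** The pullback by [h] is semisimple on the span of the generators [P_j], with
eigenvalues of positive valuation.  Eigenvectors with independent linear parts
are coordinates [U] in which [h] is diagonal; they form an automorphism since all
[P_j], hence all polynomials, are polynomials in [U]. *)
Lemma linearize d n (P : polymap K d n) (h : polymap K d d) (sigma : 'S_n)
    (a : 'I_n -> K) :
  embedding P -> (forall j, ord_ge 1 (tnth P j)) ->
  (forall j, ord_ge 1 (tnth h j)) ->
  (forall j, a j != 0) ->
  (forall j, tnth P j \mPo h = a j *: tnth P (sigma j)) ->
  (forall j, 0 < nu (orbit_prod sigma a #[sigma]%g j))%E ->
  exists (U psi : polymap K d d) (lam : 'I_d -> K) (v : 'I_d -> R),
    [/\ (forall j, ord_ge 1 (tnth U j)) /\ (forall j, ord_ge 1 (tnth psi j)),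
        polymap_comp U psi = polymap_id K d,
        polymap_comp psi U = polymap_id K d,
        (forall j, tnth U j \mPo h = lam j *: tnth U j) &
        (forall j, nu (lam j) = (v j)%:E /\ 0 < v j)].
Proof.
move=> emb P1 h1 a0 Ph nub; set N := #[sigma]%g in nub.
pose T := comp_mpoly h : {mpoly K[d]} -> {mpoly K[d]}.
have N0 : (0 < N)%N by exact: order_gt0.
have b0 j : orbit_prod sigma a N j != 0 by apply/prodf_neq0 => i _.
have PN j : iter N T (tnth P j) = orbit_prod sigma a N j *: tnth P j.
  by rewrite (iter_pullback _ _ Ph) expg_order perm1.
have /choice[x /choice[mu xmu]] j :=
  sum_of_eigenvectors charK N0 (b0 j) (PN j).
have muv j s : exists2 r : R, nu (mu j s) = r%:E & 0 < r.
  have [_ /(_ s)[_ muN]] := xmu j.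
  have [r rmu] : exists r : R, nu (mu j s) = r%:E.
    by apply: val_fin => //; apply: contra_neq (b0 j) => mu0;
       rewrite -muN mu0 expr0n gtn_eqF.
  exists r => //; have := nub j; rewrite -muN valX // rmu -EFin_natmul lte_fin.
  by rewrite pmulrn_lgt0.
have xh j s : x j s \mPo h = mu j s *: x j s.
  by have [_ /(_ s)[]] := xmu j.
(* the eigenvalue is not 1, so an eigenvector vanishes at the fixed point 0 *)
have x1 j s : ord_ge 1 (x j s).
  apply/ord_ge1P; have := constant_part_comp (x j s) h1.
  rewrite xh mcoeffZ => /eqP; rewrite -subr_eq0 -[X in _ - X]mul1r -mulrBl.
  rewrite mulf_eq0 subr_eq0 => /orP[/eqP mu1|/eqP //].
  by have [r] := muv j s; rewrite mu1 (val1 nuP) => -[<-]; rewrite ltxx.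
have Px j : tnth P j = \sum_s x j s by have [] := xmu j.
pose m := #|{: 'I_n * 'I_N}|.
pose E (i : 'I_m) := let js := enum_val i in x js.1 js.2.
have [|k|s [V]] := @choose_coordinates K m d E.
- by move=> i; exact: x1.
- have [r rP] := emb 'X_k.
  exists (fun i => r@_U_((enum_val i).1)) => l.
  have := linear_part_comp r l P1; rewrite rP mcoeffXU => ->.
  rewrite -(big_enum_val (fun js : 'I_n * 'I_N => r@_U_(js.1) * (x js.1 js.2)@_U_(l))) /=.
  rewrite -(pair_bigA _ (fun j s => r@_U_(j) * (x j s)@_U_(l))) /=.
  apply: eq_bigr => j _; rewrite Px raddf_sum mulr_sumr //.
set U := [tuple E (s k) | k < d] => -[V1 UV VU].
pose lam k := let js := enum_val (s k) in mu js.1 js.2.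
have /choice[v vP] k : exists r : R, nu (lam k) = r%:E /\ 0 < r.
  by have [r] := muv (enum_val (s k)).1 (enum_val (s k)).2; exists r.
have U1 k : ord_ge 1 (tnth U k) by rewrite tnth_mktuple; exact: x1.
have Uh k : tnth U k \mPo h = lam k *: tnth U k by rewrite tnth_mktuple; exact: xh.
have xq j t : exists q, x j t = q \mPo U.
  have mu0 : mu j t != 0 by rewrite -(val_eqy nuP); have [r -> _] := muv j t.
  have [B BP] := mon_degree_bounded nuP (fun i => (vP i).1) (fun i => (vP i).2) mu0.
  exact: (eigenvector_in_coordinates U1 V1 UV VU h1 Uh BP).
have /choice[q Pq] j : exists q, tnth P j = q \mPo U.
  have /choice[q xqE] := xq j.
  exists (\sum_t q t); rewrite Px (raddf_sum (comp_mpoly U)).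
  by apply: eq_bigr => t _; exact: xqE.
(* Q expresses the generators in U and r expresses the variables in the
   generators, so psi expresses the variables in U *)
have /choice[r rP] k : exists r, r \mPo P = 'X_k by exact: emb.
pose Q : polymap K d n := [tuple q j | j < n].
pose psi : polymap K d d := [tuple r k \mPo Q | k < d].
have psiU k : tnth psi k \mPo U = 'X_k.
  rewrite tnth_mktuple comp_mpolyA -rP; apply: (congr1 (fun g => comp_mpoly g (r k))).
  by apply: eq_from_tnth => j; rewrite !tnth_mktuple -Pq.
exists U, psi, lam, v; split=> //.
- split=> // k; apply/ord_ge1P.
  by rewrite -(constant_part_comp _ U1) psiU mcoeffX mnm1_eq0.
- apply: eq_from_tnth => k; rewrite !tnth_mktuple; apply/eqP; rewrite -subr_eq0; apply/eqP.
  (* U o psi and the identity agree after composition with U *)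
  apply: (coordinates_independent U1 V1 UV).
  rewrite comp_mpolyB comp_mpolyXU -tnth_nth comp_mpolyA.
  have -> : [tuple tnth psi i \mPo U | i < d] = [tuple 'X_i | i < d].
    by apply: eq_from_tnth => i; rewrite !tnth_mktuple -psiU tnth_mktuple.
  by rewrite comp_mpoly_id tnth_mktuple subrr.
- by apply: eq_from_tnth => k; rewrite tnth_mktuple psiU tnth_mktuple.
Qed.
End Linearize.

(** * Multiplicatively independent eigenvalues *)
Section Independent.
Variables (R : realType) (K : fieldType).
Variables (nu : K -> \bar R) (nuP : valuation nu).

Lemma iter_eigen_coeff d (U psi h : polymap K d d) lam N b (q : {mpoly K[d]}) e :
  polymap_comp U psi = polymap_id K d ->
  (forall j, tnth U j \mPo h = lam j *: tnth U j) ->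
  iter N (comp_mpoly h) (q \mPo U) = b *: (q \mPo U) ->
  mon lam e ^+ N * q@_e = b * q@_e.
Proof.
move=> Upsi Uh.
have UpsiK (p : {mpoly K[d]}) : (p \mPo U) \mPo psi = p.
  by rewrite comp_mpolyA -[RHS]comp_mpoly_id -/(polymap_id K d) -Upsi.
have -> : iter N (comp_mpoly h) (q \mPo U) = iter N (comp_mpoly (scaling_map lam)) q \mPo U.
  by elim: N => //= N ->; exact: comp_U_h.
move=> /(congr1 (comp_mpoly psi)); rewrite comp_mpolyZ !UpsiK => /(congr1 (mcoeff e)).
rewrite mcoeffZ => <-; elim: N => [|N IH]; first by rewrite expr0 mul1r.
by rewrite iterS mcoeff_comp_scaling_map -IH exprS mulrA.
Qed.

(** The eigenvalues of the monomials under the [N]-th power are distinct too, since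
[(lam^e)^N = lam^(N e)]. *)
Lemma monomialP d (lam : 'I_d -> K) N b (q : {mpoly K[d]}) :
  (0 < N)%N -> injective (mon lam) ->
  (forall e, mon lam e ^+ N * q@_e = b * q@_e) ->
  exists (c : K) (e : 'X_{1..d}), q = c *: 'X_[e].
Proof.
move=> N0 injm qN; exists q@_(mlead q), (mlead q); apply/mpolyP => e.
rewrite mcoeffZ mcoeffX; case: eqP => [<-|le]; first by rewrite mulr1.
rewrite mulr0; apply/eqP/negPn/negP => qe; apply: le.
have ql : q@_(mlead q) != 0.
  by rewrite mleadc_eq0; apply: contra_neq qe => ->; rewrite mcoeff0.
have := mulIf ql (qN (mlead q)); rewrite -(mulIf qe (qN e)) -!monX => /injm.
move=> /mnmP eN; apply/mnmP => i; have := eN i; rewrite !mulmnE => /eqP.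
by rewrite eqn_pmul2r // => /eqP.
Qed.

(** In the coordinates [U] the embedding is monomial, and for each [k] some
component is a nonzero multiple of the [k]-th coordinate because the components
generate; so the tropicalization is a tropical monomial map with a left
inverse. *)
Lemma trop_monomial_image d n (P : polymap K d n) (U psi : polymap K d d)
    (c : 'I_n -> K) (e : 'I_n -> 'X_{1..d}) :
  polymap_comp U psi = polymap_id K d -> polymap_comp psi U = polymap_id K d ->
  (forall j, tnth P j \mPo psi = c j *: 'X_[e j]) -> embedding P ->
  (forall j, ord_ge 1 (tnth P j)) -> (forall j, ord_ge 1 (tnth psi j)) ->
  homeomorphic (trop_set nu (range (polymap_eval P))) (Tspace R d).
Proof.
move=> Upsi psiU Pc emb P1 psi1.
have evalU (w : 'rV[K]_d) : polymap_eval U (polymap_eval psi w) = w.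
  apply/rowP => k; rewrite !mxE.
  have := comp_mpoly_meval (fun k => w ord0 k) (tnth U k) psi.
  have -> : tnth U k \mPo psi = 'X_k.
    by have := congr1 (fun t => tnth t k) Upsi; rewrite !tnth_mktuple.
  rewrite mevalXU => ->; apply: meval_eq => i; by rewrite mxE.
have PU j : tnth P j = (c j *: 'X_[e j]) \mPo U.
  rewrite -Pc comp_mpolyA -[LHS]comp_mpoly_id -/(polymap_id K d) -psiU.
  by [].
have Q1 j : ord_ge 1 (tnth P j \mPo psi) by exact: ord_ge_comp.
(* [r] expresses [U_k] in the components, so a term of its linear part in
   the [k]-th direction is nonzero *)
have /choice[J JP] k : exists j, c j != 0 /\ e j = U_(k)%MM.
  have [r rP] := emb (tnth U k).
  have : (tnth U k \mPo psi)@_U_(k) = 1.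
    have := congr1 (fun t => tnth t k) Upsi; rewrite !tnth_mktuple => ->.
    by rewrite mcoeffXU eqxx.
  rewrite -rP comp_mpolyA linear_part_comp => [|j]; last by rewrite tnth_mktuple.
  move=> sum1; apply/not_existsP => noj; move/eqP: sum1; rewrite big1.
    by rewrite eq_sym oner_eq0.
  move=> j _; rewrite tnth_mktuple Pc mcoeffZ mcoeffX.
  case: eqP => [ejk|_]; last by rewrite !mulr0.
  have [cj|cj] := eqVneq (c j) 0; first by rewrite cj mul0r mulr0.
  by have := noj j; case.
have /choice[r rP] k : exists r : R, nu (c (J k)) = r%:E.
  exact: val_fin (JP k).1.
have -> : trop_set nu (range (polymap_eval P)) =
          tclosure (tmonomial_map (fun j => nu (c j)) e @` Tspace R d).
  have tP (z : 'rV[K]_d) : map_mx nu (polymap_eval P z) =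
      tmonomial_map (fun j => nu (c j)) e (map_mx nu (polymap_eval U z)).
    apply/rowP => j; rewrite !mxE PU comp_mpoly_meval mevalZ mevalX valM // val_prod //.
    by congr (_ + _)%E; apply: eq_bigr => k _; rewrite !mxE valX.
  congr tclosure; apply/seteqP; split=> [_ [_ [z _ <-] <-]|_ [y yT <-]].
    rewrite tP; exists (map_mx nu (polymap_eval U z)) => //.
    by move=> k; rewrite mxE val_neqNy.
  have /choice[w wy] k : exists t, nu t = y ord0 k.
    case: (y ord0 k) (yT k) => [t _| _|] //; first exact: val_surj.
    by exists 0; exact: val0.
  exists (polymap_eval P (polymap_eval psi (\row_k w k))).
    by exists (polymap_eval psi (\row_k w k)).
  rewrite tP evalU; congr tmonomial_map.
  by apply/rowP => k; rewrite !mxE wy.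
apply: (@homeomorphic_tmonomial_image _ _ _ _ _ _ J r).
- by move=> j; exact: val_neqNy.
- by move=> k; case: (JP k).
- exact: rP.
Qed.
End Independent.

(** Two monomials with the same eigenvalue have the same weight for the positive
weights [v]; so if one has the larger first exponent, it has the smaller second
exponent, and the common factors cancel. *)
Lemma multiplicative_relation (R : realType) (K : fieldType) (nu : K -> \bar R)
    (nuP : valuation nu) (lam : 'I_2 -> K) (v : 'I_2 -> R) :
  (forall j, nu (lam j) = (v j)%:E /\ 0 < v j) -> ~ injective (mon lam) ->
  exists k l, [/\ (0 < k)%N, (0 < l)%N & lam 0 ^+ k = lam 1 ^+ l].
Proof.
move=> lamv /existsNP[e /existsNP[e' /not_implyP[ee' ne]]].
have nulam j := (lamv j).1; have v0 j := (lamv j).2.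
have lamX0 j k : lam j ^+ k != 0.
  by rewrite expf_neq0 // -(val_eqy nuP) nulam.
have one : lift ord0 ord0 = 1 :> 'I_2 by exact/val_inj.
have zero : ord0 = 0 :> 'I_2 by exact/val_inj.
have monE f : mon lam f = lam 0 ^+ f 0 * lam 1 ^+ f 1.
  by rewrite /mon big_ord_recl big_ord1 one zero.
have vE f f' : mon lam f = mon lam f' ->
    v 0 *+ f 0 + v 1 *+ f 1 = v 0 *+ f' 0 + v 1 *+ f' 1.
  move=> ff'; have := val_mon nuP nulam f; rewrite ff' (val_mon nuP nulam f').
  by rewrite !big_ord_recl !big_ord0 !one !zero !addr0 => -[].
have [e0 | e0] := eqVneq (e 0) (e' 0).
  case: ne; apply/mnmP => i; have [->|->] : i = 0 \/ i = 1.
    by case: i => -[|[|i]] // ?; [left|right]; exact/val_inj.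
  - exact: e0.
  - have := vE _ _ ee'; rewrite e0 => /addrI.
    by apply: mulrIn; rewrite gt_eqF.
wlog lt0 : e e' ee' e0 {ne} / (e' 0%R < e 0%R)%N => [wl|].
  have [lt|lt|E] := ltngtP (e 0) (e' 0); last by rewrite E eqxx in e0.
  - by apply: (wl e' e) => //; rewrite eq_sym.
  - exact: (wl e e').
have lt1 : (e 1%R < e' 1%R)%N.
  rewrite ltnNge; apply/negP => le1; have /eqP := vE _ _ ee'; rewrite gt_eqF //.
  by apply: ltr_leD; [rewrite ltr_pMn2l|rewrite ler_pMn2l].
exists (e 0%R - e' 0%R)%N, (e' 1%R - e 1%R)%N; split; rewrite ?subn_gt0 //.
apply: (mulfI (lamX0 0 (e' 0))); apply: (mulIf (lamX0 1 (e 1))).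
rewrite -exprD subnKC; last exact: ltnW.
by rewrite -mulrA -exprD subnK ?(ltnW lt1) // -!monE.
Qed.

(** * Conjugacy to a diagonal map *)

Lemma polynomial_germ (R : realType) (K : fieldType) (nu : K -> \bar R)
    (nuP : valuation nu) d n (g : polymap K d n) :
  (forall j, ord_ge 1 (tnth g j)) -> analytic_germ nu (pseries_of g).
Proof.
move=> g1; split=> [j|j]; first by apply/ord_ge1P/g1.
exists (\big[Num.min/0]_(e <- msupp (tnth g j)) fine (nu (tnth g j)@_e)), 0 => e.
rewrite mul0r subr0 /pseries_of.
have [->|ge] := eqVneq (tnth g j)@_e 0; first by rewrite val0 // leey.
have [r re] := val_fin nuP ge; rewrite re lee_fin.
have -> : r = fine (nu (tnth g j)@_e) by rewrite re.
by apply: (@ge_bigmin_seq _ _ _ _ _ e xpredT (fun e => fine (nu (tnth g j)@_e)));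
   rewrite // mcoeff_msupp.
Qed.

Lemma meval_origin (K : fieldType) n (p : {mpoly K[n]}) :
  p.@[fun k => (0 : 'rV[K]_n) ord0 k] = p@_0%MM.
Proof.
rewrite mevalE [in RHS](mpolyE p) raddf_sum /=; apply: eq_bigr => m _.
rewrite mcoeffZ mcoeffX; congr (_ * _); case: eqP => [->|/eqP].
  by rewrite big1 // => k _; rewrite mnm0E expr0.
rewrite -mdeg_eq0 mdegE sum_nat_eq0 => /forallPn[k /= mk].
by rewrite (bigD1 k) //= mxE expr0n (negPf mk) mul0r.
Qed.

Lemma preserves0_ord_ge1 (K : fieldType) d n (g : polymap K d n) j :
  preserves0 g -> ord_ge 1 (tnth g j).
Proof.
move=> /rowP/(_ j); rewrite !mxE meval_origin => g0; exact/ord_ge1P.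
Qed.

Lemma trop_perm_translation (R : realType) (K : fieldType) (nu : K -> \bar R)
    (nuP : valuation nu) n (FK : polymap K n n) F :
  perm_translation F -> (forall x, Tspace R n x -> trop_map nu FK x = F x) ->
  exists (sigma : 'S_n) (a : 'I_n -> K),
    forall j, a j != 0 /\ tnth FK j = a j *: 'X_(sigma j).
Proof.
move=> [sigma [c FE]] tropF; exists sigma.
suff /choice[a aP] j : exists b, b != 0 /\ tnth FK j = b *: 'X_(sigma j).
  by exists a.
have [x xT|b b0 bE] := @trop_linear_form R K nu nuP n (tnth FK j) (sigma j) (c j).
  by have /rowP/(_ j) := tropF x xT; rewrite FE // !mxE.
by exists b.
Qed.

Theorem theoremD (R : realType) (K : closedFieldType)
    (charK : [pchar K] =i pred0)
    (nu : K -> \bar R) (nuP : valuation nu)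
    (n : nat) (X : wcomplex R n) (F : 'rV[\bar R]_n -> 'rV[\bar R]_n)
    (XF : tropical_Hopf_data nu 2 X F)
    (XT2 : ~ homeomorphic (tset X) (Tspace R 2))
    (f : pseries_map K 2 2) (fP : realizable_by nu X F f) :
  exists alpha beta : K,
    [/\ conjugate nu f (pseries_of (diagonal_map alpha beta)),
        (0%E < nu alpha)%E, (0%E < nu beta)%E &
        exists k l : nat,
          [/\ (0 < k)%N, (0 < l)%N & alpha ^+ k = beta ^+ l]].
Proof.
have [_ Fperm _ _ _] := XF.
have [P [FK [[[emb P0] [Xtrop _] [_ _ FKc] tropF _] [f0 _] Pf]]] := fP.
have [sigma [a aP]] := trop_perm_translation nuP Fperm tropF.
have a0 j := (aP j).1; have FKE j := (aP j).2.
have P1 j : ord_ge 1 (tnth P j) by exact: preserves0_ord_ge1.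
have [h fh] := lift_polynomial emb P1 f0 Pf.
have h1 j : ord_ge 1 (tnth h j) by apply/ord_ge1P; have := f0 j; rewrite fh.
have Ph j : tnth P j \mPo h = a j *: tnth P (sigma j).
  have -> : a j *: tnth P (sigma j) = tnth (polymap_comp FK P) j.
    by rewrite tnth_mktuple FKE comp_mpolyZ comp_mpolyXU -tnth_nth.
  have := Pf; rewrite fh pseries_comp_polymap // => PhE.
  by apply/mpolyP => e; have := PhE j e; rewrite /pseries_of tnth_mktuple.
have nub j := contracting_orbit_prod FKE nuP j a0 FKc.
have [U [psi [lam [v [[U1 psi1] Upsi psiU Uh lamv]]]]] :=
  linearize charK nuP emb P1 h1 a0 Ph nub.
exists (lam 0), (lam 1); split; last 1 first.
- apply: (multiplicative_relation nuP lamv) => injm; apply: XT2; rewrite Xtrop.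
  have PU j : tnth P j = (tnth P j \mPo psi) \mPo U.
    by rewrite comp_mpolyA -[LHS]comp_mpoly_id -/(polymap_id K 2) -psiU.
  have /choice[c /choice[e Pc]] j :
      exists c e, tnth P j \mPo psi = c *: 'X_[e].
    apply: (monomialP (order_gt0 sigma) injm) => e.
    apply: (iter_eigen_coeff e Upsi Uh); rewrite -PU.
    by rewrite (iter_pullback _ _ Ph) expg_order perm1.
  exact: (trop_monomial_image nuP Upsi psiU Pc emb P1 psi1).
- have diagE : diagonal_map (lam 0) (lam 1) = scaling_map lam.
    apply: eq_from_tnth => -[[|[|j]] jP] //; rewrite tnth_mktuple (tnth_nth 0) /=.
    + by congr (lam _ *: 'X_ _); exact/val_inj.
    + by congr (lam _ *: 'X_ _); exact/val_inj.
  exists (pseries_of U), (pseries_of psi); split.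
  + exact: polynomial_germ.
  + exact: polynomial_germ.
  + by rewrite pseries_comp_polymap // Upsi.
  + by rewrite pseries_comp_polymap // psiU.
  + rewrite diagE fh (pseries_comp_polymap _ h1) (pseries_comp_polymap _ U1).
    suff -> : polymap_comp U h = polymap_comp (scaling_map lam) U by [].
    apply: eq_from_tnth => j.
    by rewrite !tnth_mktuple Uh comp_mpolyZ comp_mpolyXU -tnth_nth.
- by have [-> ?] := lamv 0; rewrite lte_fin.
- by have [-> ?] := lamv 1; rewrite lte_fin.
Qed.
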